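(* Let $1<p<\frac{N+2\gamma}{1+2\gamma}$, $1<q<\infty$, $0<r<\infty$ with $p+q\geq r$. Let also $\delta\in[0,1]\cap\left[\frac{r-q}{r},\frac{p}{r}\right]$ and $b,c\in\mathbb{R}$. Assume that $$\frac{\delta r}{p}+\frac{(1-\delta)r}{q}=1\quad\text{and}\quad c=-\delta+b(1-\delta).$$ Then there is a constant $C>0$, independent of $f$, such that for all $f\in C_c^{\infty}(\mathbb{R}^N)$ $$\||x|^{c}f\|_{r}\leq C\,\|\nabla_{k}f\|^{\delta}_{p}\,\||x|^{b}f\|^{1-\delta}_{q}.$$
   Context: Dunkl setting. $N\ge 1$ is an integer. $R\subset\mathbb{R}^N\setminus\{0\}$ is a fixed finite root system: $R\cap\alpha\mathbb{R}=\{-\alpha,\alpha\}$ and $\sigma_\alpha(R)=R$ for all $\alpha\in R$, where $\sigma_\alpha x=x-2\frac{\langle\alpha,x\rangle}{\langle\alpha,\alpha\rangle}\alpha$; roots are normalised by $|\alpha|^2=2$. $G$ is the finite group generated by the $\sigma_\alpha$. $k:R\to[0,\infty)$, $\alpha\mapsto k_\alpha$, is a fixed $G$-invariant function ($k_{g\alpha}=k_\alpha$ for all $g\in G$). $R_+$ is a fixed positive subsystem ($R=R_+\sqcup(-R_+)$), and $\gamma=\sum_{\alpha\in R_+}k_\alpha$. Dunkl operators: for $i=1,\dots,N$, $$T_if(x)=\partial_if(x)+\sum_{\alpha\in R_+}k_\alpha\alpha_i\frac{f(x)-f(\sigma_\alpha x)}{\langle\alpha,x\rangle}.$$ The Dunkl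 gradient is $\nabla_k=(T_1,\dots,T_N)$. The measure is $d\mu_k=w_k(x)\,dx$ with $w_k(x)=\prod_{\alpha\in R_+}|\langle\alpha,x\rangle|^{2k_\alpha}$; for $0<p<\infty$, $\|g\|_p=\left(\int_{\mathbb{R}^N}|g|^p\,d\mu_k\right)^{1/p}$, and $\|\nabla_kf\|_p=\||\nabla_kf|\|_p$. *)

(* Defs.v *)
From HB Require Import structures.
From mathcomp Require Import all_boot all_order all_algebra finmap.
From mathcomp Require Import all_classical all_reals all_analysis.
From mathcomp Require Import measurable_realfun.

Set Implicit Arguments.
Unset Strict Implicit.
Unset Printing Implicit Defensive.

Import Order.TTheory GRing.Theory Num.Theory.
Import numFieldNormedType.Exports.

Local Open Scope classical_set_scope.
Local Open Scope ring_scope.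

(* Row vectors carry the sigma-algebra generated by the coordinates; on
   'rV[R]_n this is the Borel sigma-algebra. *)
Definition measure_row_display : measure_display -> measure_display.
Proof. exact. Qed.

Section measurable_row.
Context {d : measure_display} {T : measurableType d} (n : nat).

Let coord : 'I_n -> 'rV[T]_n -> T := fun i x => x ord0 i.

Let row_set0 : g_sigma_preimage coord set0.
Proof. exact: sigma_algebra0. Qed.

Let row_setC A : g_sigma_preimage coord A -> g_sigma_preimage coord (~` A).
Proof. exact: sigma_algebraC. Qed.

Let row_bigcup (F : (set 'rV[T]_n)^nat) :
  (forall i, g_sigma_preimage coord (F i)) ->
  g_sigma_preimage coord (\bigcup_i F i).
Proof. exact: sigma_algebra_bigcup. Qed.

HB.instance Definition _ := @isMeasurable.Build (measure_row_display d)
  'rV[T]_n (g_sigma_preimage coord) row_set0 row_setC row_bigcup.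

Lemma measurable_coord (i : 'I_n) :
  measurable_fun [set: 'rV[T]_n] (fun x : 'rV[T]_n => x ord0 i).
Proof.
move=> _ Y mY; rewrite setTI; apply: sub_sigma_algebra => /=.
rewrite -bigcup_seq/=; exists i => /=; first by rewrite mem_index_enum.
by exists Y => //; rewrite setTI.
Qed.

Lemma measurable_rowP d1 (T1 : measurableType d1) (f : T1 -> 'rV[T]_n) :
  (forall i, measurable_fun [set: T1] (fun x => f x ord0 i)) ->
  measurable_fun [set: T1] f.
Proof.
move=> mf; apply: (@measurability _ _ _ _ _ _
  (\big[setU/set0]_(i < n) preimage_set_system setT (coord i) measurable)) => //.
move=> _ [B + <-]; rewrite -bigcup_seq => -[i _] [C mC <-].
by rewrite !setTI -comp_preimage -[X in measurable X]setTI; exact: mf.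
Qed.

End measurable_row.

Section lebesgue_row.
Context {R : realType}.
Implicit Types n : nat.

Definition cons_row n (p : R * 'rV[R]_n) : 'rV[R]_n.+1 :=
  row_mx (const_mx p.1 : 'rV[R]_1) p.2.

Definition uncons_row n (x : 'rV[R]_n.+1) : R * 'rV[R]_n :=
  (x ord0 ord0, rsubmx (x : 'rV[R]_(1 + n))).

Lemma cons_rowK n : cancel (@cons_row n) (@uncons_row n).
Proof.
case=> a v; rewrite /uncons_row /cons_row row_mxKr; congr pair => /=.
by rewrite mxE; case: splitP => j; rewrite ?mxE.
Qed.

Lemma cons_row0 n (p : R * 'rV[R]_n) : cons_row p ord0 ord0 = p.1.
Proof. exact: (congr1 fst (cons_rowK p)). Qed.

Lemma cons_rowS n (p : R * 'rV[R]_n) (i : 'I_n) :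
  cons_row p ord0 (lift ord0 i) = p.2 ord0 i.
Proof.
have -> : lift ord0 i = rshift 1 i by apply: val_inj.
exact: row_mxEr.
Qed.

Lemma measurable_cons_row n : measurable_fun setT (@cons_row n).
Proof.
apply: measurable_rowP => i.
have [j ij|j ij] := split_ordP (i : 'I_(1 + n)).
  rewrite (_ : (fun _ => _) = fst); first exact: measurable_fst.
  by apply/funext => p; rewrite ij; exact: etrans (row_mxEl _ _ _ _) (mxE _ _ _ _).
rewrite (_ : (fun _ => _) = (fun x : 'rV[R]_n => x ord0 j) \o snd).
  exact: (measurableT_comp (measurable_coord j) measurable_snd).
by apply/funext => p; rewrite ij; exact: row_mxEr.
Qed.

HB.instance Definition _ n :=
  isMeasurableFun.Build _ _ _ _ (@cons_row n) (@measurable_cons_row n).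

Lemma measurable_uncons_row n : measurable_fun setT (@uncons_row n).
Proof.
apply: measurable_fun_pair => /=; first exact: measurable_coord.
apply: measurable_rowP => i.
under eq_fun do rewrite mxE.
exact: measurable_coord.
Qed.

Section step.
Context n (m : {sigma_finite_measure set 'rV[R]_n -> \bar R}).

Definition lebesgue_cons : set 'rV[R]_n.+1 -> \bar R :=
  pushforward (@lebesgue_measure R \x m)%E (@cons_row n).

Let lebesgue_cons0 : lebesgue_cons set0 = 0%E.
Proof. by rewrite /lebesgue_cons /pushforward preimage_set0 measure0. Qed.

Let lebesgue_cons_ge0 A : (0 <= lebesgue_cons A)%E.
Proof. by rewrite /lebesgue_cons /pushforward measure_ge0. Qed.

Let lebesgue_cons_sigma_additive : semi_sigma_additive lebesgue_cons.
Proof.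
move=> F mF tF mUF; rewrite /lebesgue_cons /pushforward preimage_bigcup.
have mV A : measurable A -> measurable (@cons_row n @^-1` A).
  by move=> mA; rewrite -[X in measurable X]setTI; exact: measurable_cons_row.
apply: measure_semi_sigma_additive; first by move=> i; exact: mV.
  apply/trivIsetP => /= i j _ _ ij; rewrite -preimage_setI.
  by move/trivIsetP : tF => /(_ _ _ _ _ ij) ->//; rewrite preimage_set0.
by rewrite -preimage_bigcup; exact: mV.
Qed.

HB.instance Definition _ := isMeasure.Build _ _ _ lebesgue_cons
  lebesgue_cons0 lebesgue_cons_ge0 lebesgue_cons_sigma_additive.

Let lebesgue_cons_sigma_finite : sigma_finite setT lebesgue_cons.
Proof.
have /sigma_finiteP[F [FT ndF Foo]] := sigma_finiteT (@lebesgue_measure R).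
have /sigma_finiteP[G [GT ndG Goo]] := sigma_finiteT m.
exists (fun i => @uncons_row n @^-1` (F i `*` G i)).
  rewrite -preimage_bigcup; apply/esym; rewrite -subTset => x _ /=.
  have : setT (uncons_row x).1 by [].
  have : setT (uncons_row x).2 by [].
  rewrite [in X in X -> _]GT [in X in _ -> X -> _]FT => -[j _ Gj] [i _ Fi].
  exists (maxn i j) => //; split.
    by move: Fi; exact/subsetPset/ndF/leq_maxl.
  by move: Gj; exact/subsetPset/ndG/leq_maxr.
move=> i; have [mF Fi] := Foo i; have [mG Gi] := Goo i; split.
  rewrite -[X in measurable X]setTI; apply: measurable_uncons_row => //.
  exact: measurableX.
rewrite /lebesgue_cons /pushforward -comp_preimage.
rewrite (_ : _ \o _ = id); last by apply/funext => p; exact: cons_rowK.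
by rewrite preimage_id product_measure1E// lte_mul_pinfty// ge0_fin_numE.
Qed.

HB.instance Definition _ := Measure_isSigmaFinite.Build _ _ _ lebesgue_cons
  lebesgue_cons_sigma_finite.

End step.

Fixpoint lebesgue_row n : {sigma_finite_measure set 'rV[R]_n -> \bar R} :=
  match n with
  | 0 => \d_(0 : 'rV[R]_0)
  | n'.+1 => lebesgue_cons (lebesgue_row n')
  end.

Lemma measurable_row_box n (A : 'I_n -> set R) :
  (forall i, measurable (A i)) ->
  measurable [set x : 'rV[R]_n | forall i, A i (x ord0 i)].
Proof.
move=> mA.
rewrite (_ : [set _ | _] = \bigcap_(i in [set: 'I_n])
    ((fun x : 'rV[R]_n => x ord0 i) @^-1` A i)); last first.
  by apply/seteqP; split=> x /= Ax i; [move=> _|]; exact: Ax.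
apply: fin_bigcap_measurable; first exact: finite_finset.
move=> i _.
rewrite -[X in measurable X]setTI.
exact: (measurable_coord (T := R) i measurableT (mA i)).
Qed.

(* lebesgue_row n is the n-fold product of the Lebesgue measure on R. *)
Lemma lebesgue_row_box n (A : 'I_n -> set R) :
  (forall i, measurable (A i)) ->
  lebesgue_row n [set x | forall i, A i (x ord0 i)] =
  (\prod_(i < n) lebesgue_measure (A i))%E.
Proof.
elim: n A => [|n IH] A mA.
  by rewrite big_ord0 /= diracE mem_set // => -[].
rewrite big_ord_recl -IH; last by move=> i; exact: mA.
rewrite -product_measure1E//; last first.
  exact: (measurable_row_box (A := fun i => A (lift ord0 i))).
  exact: (mA ord0).
rewrite /= /lebesgue_cons /pushforward; congr (product_measure1 _ _ _).
apply/seteqP; split=> [p /= Ap|p [/= Ap0 Ap] i /=].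
  by split=> /= [|i]; [have := Ap ord0; rewrite cons_row0|
                       have := Ap (lift ord0 i); rewrite cons_rowS].
have [j ij|j ij] := split_ordP (i : 'I_(1 + n)).
  have -> : i = ord0 by rewrite ij ord1; apply: val_inj.
  by rewrite cons_row0.
have -> : i = lift ord0 j by rewrite ij; apply: val_inj.
by rewrite cons_rowS; exact: Ap.
Qed.

End lebesgue_row.

Section dunkl.
Context {R : realType} {N : nat}.
Local Notation V := 'rV[R]_N.
Implicit Types (a x y : V) (Phi P : {fset V}) (k : V -> R) (f : V -> R).

Definition dotp x y : R := \sum_(i < N) x ord0 i * y ord0 i.

(* The library's norm on 'rV[R]_N is the sup norm. *)
Definition enorm x : R := Num.sqrt (dotp x x).

Definition reflection a x : V := x - (2 * (dotp a x / dotp a a)) *: a.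

Record root_system Phi : Prop := RootSystem {
  root_neq0 : 0 \notin Phi;
  root_line : forall a, a \in Phi ->
    [set` Phi] `&` [set t *: a | t in [set: R]] = [set - a; a];
  root_reflection : forall a, a \in Phi ->
    [set reflection a x | x in [set` Phi]] = [set` Phi];
  root_normalized : forall a, a \in Phi -> enorm a ^+ 2 = 2
}.

(* The group of maps of R^N generated by the reflections in the roots. *)
Inductive reflection_group Phi : (V -> V) -> Prop :=
| reflection_group_id : reflection_group Phi id
| reflection_group_gen a : a \in Phi -> reflection_group Phi (reflection a)
| reflection_group_comp g h : reflection_group Phi g ->
    reflection_group Phi h -> reflection_group Phi (g \o h)
| reflection_group_inv g h : reflection_group Phi g ->
    cancel g h -> cancel h g -> reflection_group Phi h.

Definition positive_subsystem Phi P : Prop :=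
  [set` Phi] = [set` P] `|` [set - a | a in [set` P]] /\
  [set` P] `&` [set - a | a in [set` P]] = set0.

(* Only the values of k on the roots are constrained (and used). *)
Definition multiplicity Phi k : Prop :=
  (forall a, a \in Phi -> 0 <= k a) /\
  (forall g a, reflection_group Phi g -> a \in Phi -> k (g a) = k a).

Definition dunkl_gamma P k : R := \sum_(a <- P) k a.

Definition dunkl_weight P k x : R := \prod_(a <- P) `|dotp a x| `^ (2 * k a).

Lemma measurable_dotp a : measurable_fun [set: V] (dotp a).
Proof.
apply: measurable_sum => i; apply: measurable_funM => //.
exact: measurable_coord.
Qed.

Lemma dunkl_weight_ge0 P k x : 0 <= dunkl_weight P k x.
Proof. by apply: prodr_ge0 => a _; exact: powR_ge0. Qed.

Lemma measurable_dunkl_weight P k : measurable_fun [set: V] (dunkl_weight P k).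
Proof.
apply: measurable_prod => a _.
apply: (measurableT_comp (measurable_powR _)).
apply: measurableT_comp => //; exact: measurable_dotp.
Qed.

Definition dunkl_measure P k (A : set V) : \bar R :=
  (\int[lebesgue_row N]_(x in A) (dunkl_weight P k x)%:E)%E.

Section dunkl_measure.
Variables (P : {fset V}) (k : V -> R).

Let dunkl_measure0 : dunkl_measure P k set0 = 0%E.
Proof. exact: integral_set0. Qed.

Let dunkl_measure_ge0 A : (0 <= dunkl_measure P k A)%E.
Proof. by apply: integral_ge0 => x _; rewrite lee_fin dunkl_weight_ge0. Qed.

Let dunkl_measure_sigma_additive : semi_sigma_additive (dunkl_measure P k).
Proof.
move=> F mF tF mUF; rewrite /dunkl_measure ge0_integral_bigcup//=.
- by apply: is_cvg_ereal_nneg_natsum_cond => n _ _; exact: dunkl_measure_ge0.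
- by apply/measurable_EFinP; apply: measurable_funTS;
    exact: measurable_dunkl_weight.
- by move=> x _; rewrite lee_fin dunkl_weight_ge0.
Qed.

HB.instance Definition _ := isMeasure.Build _ _ _ (dunkl_measure P k)
  dunkl_measure0 dunkl_measure_ge0 dunkl_measure_sigma_additive.

End dunkl_measure.

Definition dunkl_norm P k (p : R) (g : V -> R) : \bar R :=
  'N[dunkl_measure P k]_(p%:E)[EFin \o g]%E.

Definition partial (i : 'I_N) f : V -> R :=
  fun x => 'D_(delta_mx ord0 i : V) f x.

(* f is of class C^oo: all its iterated partial derivatives, the one along the
   multi-index s being foldr partial f s, exist and are continuous. *)
Definition smooth f : Prop := forall s : seq 'I_N,
  continuous (foldr partial f s) /\
  forall (i : 'I_N) x,
    derivable (foldr partial f s) x (delta_mx ord0 i : V).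

Definition test_function f : Prop :=
  smooth f /\ compact (closure [set x | f x != 0]).

(* On the hyperplanes dotp a x = 0, which are null sets, the quotient is 0 by
   the convention y / 0 = 0 instead of its limit value. *)
Definition dunkl_op P k (i : 'I_N) f : V -> R := fun x =>
  partial i f x +
  \sum_(a <- P) k a * a ord0 i * ((f x - f (reflection a x)) / dotp a x).

Definition dunkl_grad P k f : V -> V :=
  fun x => \row_(i < N) dunkl_op P k i f x.

End dunkl.

(* Main.v *)
(* Hoelder's inequality with exponents p / (delta r) and q / ((1 - delta) r)
   reduces the claim to the Hardy inequality |f / |x||_p <= C |nabla_k f|_p.

   For the latter let A be the norm of f / max(|x|, e), and let E be the Euler
   operator sum_i x_i d_i. The measure mu_k is homogeneous of degree
   N + 2 gamma, so dilating f by 1 + t multiplies A by at most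
   (1 + t)^(- kappa), kappa = (N + 2 gamma - p) / p. Comparing f with its
   dilate and letting t -> 0 gives kappa A <= |E f / max(|x|, e)|_p.
   Pointwise E f = <x, nabla_k f> - sum_a k_a (f - f o sigma_a), and mu_k and
   |x| are invariant under the reflections, so the right-hand side is at most
   |nabla_k f|_p + 2 gamma A. The assumption on p says 2 gamma < kappa, and A is
   finite, so A is absorbed; finally e -> 0.

   The invariance of Lebesgue measure under reflections and its behaviour under
   dilations both come from the uniqueness of translation-invariant measures. *)
From HB Require Import structures.
Require Import Defs.
From mathcomp Require Import all_boot all_order all_algebra finmap.
From mathcomp Require Import all_classical all_reals all_analysis.
From mathcomp Require Import measurable_realfun.
From mathcomp Require Import ring lra.

Set Implicit Arguments.
Unset Strict Implicit.
Unset Printing Implicit Defensive.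

Import Order.TTheory GRing.Theory Num.Theory.
Import numFieldNormedType.Exports.

Local Open Scope classical_set_scope.
Local Open Scope ring_scope.

Lemma preimage_measurable d1 d2 (T1 : measurableType d1) (T2 : measurableType d2)
    (f : T1 -> T2) (A : set T2) :
  measurable_fun [set: T1] f -> measurable A -> measurable (f @^-1` A).
Proof. by move=> mf mA; rewrite -[X in measurable X]setTI; exact: mf. Qed.

(** * Translation invariance of Lebesgue measure and its uniqueness up to a factor *)

Section lebesgue_row_invariance.
Context {R : realType}.

Lemma measurable_row_lin d (T : measurableType d) n (f g : T -> 'rV[R]_n) (c : R) :
  measurable_fun [set: T] f -> measurable_fun [set: T] g ->
  measurable_fun [set: T] (fun x => f x + c *: g x).
Proof.
move=> mf mg; apply: measurable_rowP => i; under eq_fun do rewrite !mxE.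
apply: measurable_funD; first exact: measurableT_comp (measurable_coord i) mf.
apply: measurable_funM => //; exact: measurableT_comp (measurable_coord i) mg.
Qed.

(** The image of Lebesgue measure under a translation still gives half-open intervals their length,
    and this determines the measure. *)
Lemma lebesgue_measure_shift (a : R) (A : set R) : measurable A ->
  lebesgue_measure ((fun x : R => x + a) @^-1` A) = lebesgue_measure A.
Proof.
move=> mA.
have ms : measurable_fun [set: R] (fun x : R => (x + a : measurableTypeR R)).
  exact: measurable_funD.
pose s := HB.pack (fun x : R => (x + a : measurableTypeR R))
  (isMeasurableFun.Build _ _ _ _ _ ms) : {mfun R >-> measurableTypeR R}.
apply/esym.
apply: (@lebesgue_measure_unique R (pushforward lebesgue_measure s)) => //.
move=> _ [[u v] _ <-] /=; rewrite /pushforward.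
rewrite (_ : s @^-1` _ = `]u - a, v - a]%classic); last first.
  by apply/seteqP; split => x; rewrite /= !in_itv/= ltrBlDr lerBrDr.
by rewrite !lebesgue_measure_itv/= !lte_fin -!EFinB ltrD2r opprB addrA subrK.
Qed.

Lemma ge0_integral_shift (a : R) (f : measurableTypeR R -> \bar R) :
  measurable_fun [set: measurableTypeR R] f -> (forall x, 0 <= f x)%E ->
  (\int[lebesgue_measure]_x f (x + a)%R = \int[lebesgue_measure]_x f x)%E.
Proof.
move=> mf f0.
have ms : measurable_fun [set: measurableTypeR R]
    (fun x : measurableTypeR R => (x + a : measurableTypeR R)).
  have ms : measurable_fun [set: R] (fun x : R => x + a) by exact: measurable_funD.
  exact ms.
have := @ge0_integral_pushforward _ _ _ _ R _ ms lebesgue_measure setT f measurableT mf.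
move=> /(_ (fun x _ => f0 x)); rewrite preimage_setT => <-.
by apply: eq_measure_integral => A mA _; rewrite -[RHS](lebesgue_measure_shift a mA).
Qed.

(** Induction on the dimension: invariance on the line moves the first coordinate, the induction
    hypothesis moves the sections. *)
Lemma lebesgue_row_shift n (v : 'rV[R]_n) (A : set 'rV[R]_n) : measurable A ->
  lebesgue_row n ((fun x => x + v) @^-1` A) = lebesgue_row n A.
Proof.
elim: n v A => [|n IH] v A mA.
  congr (_ _); apply/seteqP; split => x /=; by rewrite [v]thinmx0 addr0.
rewrite /= /lebesgue_cons /pushforward /product_measure1.
set B := @cons_row R n @^-1` A.
have mB : measurable B.
  exact: (preimage_measurable (@measurable_cons_row R n) mA).
transitivity (\int[@lebesgue_measure R]_x
    (lebesgue_row n \o xsection B) (x + v ord0 ord0)%R)%E; last first.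
  have mfB := measurable_fun_xsection (lebesgue_row n) mB.
  apply: ge0_integral_shift => [|x]; [exact mfB|exact: measure_ge0].
apply: eq_integral => x _ /=.
rewrite -[RHS](IH (rsubmx (v : 'rV_(1 + n)))); last exact: measurable_xsection.
congr (lebesgue_row n _); apply/seteqP; split => y /=;
  rewrite /xsection /= !inE /B /=; congr (A _);
  apply/rowP => i; case: (unliftP ord0 i) => [j|] ->;
  rewrite ?cons_rowS ?cons_row0/= ![(_ + v) _ _]mxE ?cons_rowS ?cons_row0 ?mxE//;
  congr (_ + v _ _); exact: val_inj.
Qed.

Lemma section_tonelli d1 d2 (T1 : measurableType d1) (T2 : measurableType d2)
    (m1 : {sigma_finite_measure set T1 -> \bar R})
    (m2 : {sigma_finite_measure set T2 -> \bar R}) (E : set (T1 * T2)) :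
  measurable E ->
  (\int[m1]_x m2 (xsection E x) = \int[m2]_y m1 (ysection E y))%E.
Proof.
move=> mE.
have := indic_fubini_tonelli m1 m2 mE.
by rewrite indic_fubini_tonelli_FE// indic_fubini_tonelli_GE.
Qed.

(* Tonelli applied to 1_A(x + y) 1_B(y), first as it stands and then after the
   substitution y := y - x. *)
Lemma shift_invariant_measureE n
    (nu : {sigma_finite_measure set 'rV[R]_n -> \bar R}) :
  (forall (v : 'rV[R]_n) (A : set 'rV[R]_n), measurable A ->
     nu ((fun x => x + v) @^-1` A) = nu A) ->
  forall A B, measurable A -> measurable B ->
  (nu A * lebesgue_row n B =
   nu ((fun x : 'rV[R]_n => - x)%R @^-1` B) * lebesgue_row n A)%E.
Proof.
move=> hnu A B mA mB.
have ms (c : R) : measurable_fun [set: 'rV[R]_n * 'rV[R]_n]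
    (fun z : 'rV[R]_n * 'rV[R]_n => z.2 + c *: z.1).
  exact: measurable_row_lin.
have mN : measurable_fun [set: 'rV[R]_n] (fun x : 'rV[R]_n => - x).
  apply: (eq_measurable_fun (fun x : 'rV[R]_n => 0 + (- 1) *: x)).
    by move=> x _; rewrite add0r scaleN1r.
  by apply: measurable_row_lin.
(* [E1] carries the integrand before the substitution and [E2] the one after it; the coefficients
   [1] and [-1] let [ms] serve both. *)
pose E1 := [set z : 'rV[R]_n * 'rV[R]_n | A (z.2 + 1 *: z.1) /\ B z.2].
pose E2 := [set z : 'rV[R]_n * 'rV[R]_n | A z.2 /\ B (z.2 + (-1) *: z.1)].
have mE1 : measurable E1.
  apply: measurableI; first exact: preimage_measurable (ms 1) mA.
  exact: preimage_measurable measurable_snd mB.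
have mE2 : measurable E2.
  apply: measurableI; first exact: preimage_measurable measurable_snd mA.
  exact: preimage_measurable (ms (-1)) mB.
have intM (k : \bar R) (D : set 'rV[R]_n) : measurable D -> (0 <= k)%E ->
    (\int[lebesgue_row n]_y (k * (\1_D y)%:E) = k * lebesgue_row n D)%E.
  move=> mD k0; rewrite ge0_integralZl//.
  - by rewrite integral_indic// setIT.
  - by apply/measurable_EFinP; exact: measurable_indic.
(* The section of [E1] at y is a translate of [A] if y lies in [B], and empty otherwise. Likewise,
   the section of [E2] at y is a translate of [-B] if y lies in [A], and empty otherwise. *)
transitivity (\int[lebesgue_row n]_y nu (ysection E1 y))%E.
  rewrite -intM//; apply: eq_integral => y _.
  rewrite indicE; have [yB|yB] := boolP (y \in B).
    rewrite mule1 -(hnu y)//; congr (nu _).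
    by apply/seteqP; split => x /=; rewrite /ysection /= inE /E1 /= scale1r (addrC y) => *;
      [split => //; exact/set_mem|tauto].
  rewrite mule0 -(measure0 nu); congr (nu _).
  apply/esym; rewrite -subset0 => x; rewrite /ysection /= inE => -[_ By].
  by move: yB; rewrite notin_setE.
rewrite -section_tonelli//.
transitivity (\int[nu]_x lebesgue_row n (xsection E2 x))%E.
  apply: eq_integral => x _; rewrite -[RHS](lebesgue_row_shift x); last first.
    exact: measurable_xsection.
  congr (lebesgue_row n _); apply/seteqP; split => y /=;
    by rewrite /xsection /= !inE /E1 /E2 /= scale1r scaleN1r addrK.
rewrite section_tonelli// -intM; [|by []|exact: measure_ge0].
apply: eq_integral => y _.
rewrite indicE; have [yA|yA] := boolP (y \in A).
  rewrite mule1 -[RHS](hnu (- y)); last exact: preimage_measurable mN mB.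
  congr (nu _); apply/seteqP; split => x /=;
    rewrite /ysection /= inE /E2 /= scaleN1r opprD opprK addrC.
    by case.
  by split => //; exact/set_mem.
rewrite mule0 -(measure0 nu); congr (nu _).
rewrite -subset0 => x; rewrite /ysection /= inE => -[Ay _].
by move: yA; rewrite notin_setE.
Qed.

End lebesgue_row_invariance.

(** * Euclidean inner product, norm and reflections *)

Section dotp_theory.
Context {R : realType} {N : nat}.
Implicit Types (a b x y : 'rV[R]_N).

Lemma dotpC x y : dotp x y = dotp y x.
Proof. by apply: eq_bigr => i _; rewrite mulrC. Qed.

Lemma dotpDr a x y : dotp a (x + y) = dotp a x + dotp a y.
Proof. by rewrite -big_split; apply: eq_bigr => i _; rewrite mxE mulrDr. Qed.

Lemma dotpZr a c x : dotp a (c *: x) = c * dotp a x.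
Proof. by rewrite mulr_sumr; apply: eq_bigr => i _; rewrite mxE mulrCA. Qed.

Lemma dotpBr a x y : dotp a (x - y) = dotp a x - dotp a y.
Proof. by rewrite -scaleN1r dotpDr dotpZr mulN1r. Qed.

Lemma dotp_ge0 x : 0 <= dotp x x.
Proof. by apply: sumr_ge0 => i _; rewrite -expr2 sqr_ge0. Qed.

Lemma enorm_ge0 x : 0 <= enorm x. Proof. exact: sqrtr_ge0. Qed.

Lemma enorm_sqr x : enorm x ^+ 2 = dotp x x.
Proof. by rewrite sqr_sqrtr// dotp_ge0. Qed.

Lemma enormZ c x : 0 <= c -> enorm (c *: x) = c * enorm x.
Proof.
move=> c0; rewrite /enorm dotpZr dotpC dotpZr mulrA -expr2 sqrtrM ?sqr_ge0//.
by rewrite sqrtr_sqr ger0_norm.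
Qed.

Lemma coord_le_enorm x i : `|x ord0 i| <= enorm x.
Proof.
rewrite -sqrtr_sqr ler_wsqrtr// /dotp (bigD1 i)//= -expr2 lerDl.
by apply: sumr_ge0 => j _; rewrite -expr2 sqr_ge0.
Qed.

Lemma enorm_eq0 x : enorm x = 0 -> x = 0.
Proof.
move=> x0; apply/rowP => i; rewrite mxE; apply/eqP; rewrite -normr_le0 -x0.
exact: coord_le_enorm.
Qed.

(** Cauchy-Schwarz: for nonzero x, the vector [dotp x x *: y - dotp x y *: x] has nonnegative
    squared length, and one factor [dotp x x] can be divided out. *)
Lemma dotp_le x y : `|dotp x y| <= enorm x * enorm y.
Proof.
have [x0|x0] := eqVneq (dotp x x) 0.
  have -> : x = 0 by apply: enorm_eq0; rewrite /enorm x0 sqrtr0.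
  rewrite /dotp big1 ?normr0 ?mulr_ge0 ?enorm_ge0// => i _.
  by rewrite mxE mul0r.
rewrite -ler_sqr ?nnegrE ?mulr_ge0 ?enorm_ge0// exprMn !enorm_sqr -normrX.
rewrite ger0_norm ?sqr_ge0//.
have := dotp_ge0 (dotp x x *: y - dotp x y *: x).
rewrite dotpBr !dotpZr ![dotp (_ - _) _]dotpC !dotpBr !dotpZr (dotpC y x).
have : 0 < dotp x x by rewrite lt_neqAle eq_sym x0 dotp_ge0.
set u := dotp x x; set v := dotp x y; set w := dotp y y => u0 h.
rewrite -(ler_pM2l u0); nra.
Qed.

Lemma measurable_enorm : measurable_fun [set: 'rV[R]_N] (@enorm R N).
Proof.
have -> : @enorm R N = (fun x => dotp x x `^ 2^-1).
  by apply/funext => x; rewrite powR12_sqrt// dotp_ge0.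
apply: (measurableT_comp (measurable_powR _)).
apply: measurable_sum => i; apply: measurable_funM; exact: measurable_coord.
Qed.

Lemma measurable_reflection a :
  measurable_fun [set: 'rV[R]_N] (reflection a : 'rV[R]_N -> 'rV[R]_N).
Proof.
apply: measurable_rowP => i; under eq_fun do rewrite !mxE.
apply: measurable_funB; first exact: measurable_coord.
apply: measurable_funM => //; apply: measurable_funM => //.
apply: measurable_funM => //; exact: measurable_dotp.
Qed.

Lemma reflectionE a x : dotp a a = 2 -> reflection a x = x - dotp a x *: a.
Proof.
by move=> a2; rewrite /reflection a2 mulrC divfK// pnatr_eq0.
Qed.

Lemma reflectionK a : dotp a a = 2 -> involutive (reflection a).
Proof.
move=> a2 x; rewrite !reflectionE// dotpBr dotpZr a2.
rewrite -addrA -opprD -scalerDl [X in X *: a](_ : _ = 0).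
  by rewrite scale0r subr0.
ring.
Qed.

(** Both sides equal <x, y> - <a, x><a, y>. With [reflectionK], this self-adjointness makes
    reflections isometries. *)
Lemma dotp_reflection a x y : dotp a a = 2 ->
  dotp (reflection a x) y = dotp x (reflection a y).
Proof.
move=> a2; rewrite !reflectionE// !dotpBr dotpC dotpBr !dotpZr.
by rewrite (dotpC y) (dotpC y a) (dotpC x a) mulrC.
Qed.

Lemma enorm_reflection a x : dotp a a = 2 -> enorm (reflection a x) = enorm x.
Proof.
by move=> a2; rewrite /enorm dotp_reflection// reflectionK.
Qed.

End dotp_theory.

(** * Lebesgue measure under dilations and reflections *)

Section lebesgue_row_linear.
Context {R : realType} (n : nat).
Local Notation V := 'rV[R]_n.

Section bijection.
Variables (T S : V -> V).
Hypotheses (mT : measurable_fun [set: V] T) (mS : measurable_fun [set: V] S).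
Hypotheses (TK : cancel T S) (TD : {morph T : x y / x + y}).

(** The image of Lebesgue measure under [T], named so that it can carry the sigma-finite structure
    that [shift_invariant_measureE] asks of [nu]. *)
Definition lebesgue_preimage (A : set V) : \bar R := lebesgue_row n (T @^-1` A).

Let lebesgue_preimage0 : lebesgue_preimage set0 = 0%E.
Proof. by rewrite /lebesgue_preimage preimage_set0 measure0. Qed.

Let lebesgue_preimage_ge0 A : (0 <= lebesgue_preimage A)%E.
Proof. exact: measure_ge0. Qed.

Let lebesgue_preimage_sigma_additive : semi_sigma_additive lebesgue_preimage.
Proof.
exact: (@measure_semi_sigma_additive _ _ _
  (measure_function_pushforward__canonical__measure_function_Measure
    (lebesgue_row n) mT)).
Qed.

HB.instance Definition _ := isMeasure.Build _ _ _ lebesgue_preimage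
  lebesgue_preimage0 lebesgue_preimage_ge0 lebesgue_preimage_sigma_additive.

Let lebesgue_preimage_sigma_finite : sigma_finite setT lebesgue_preimage.
Proof.
have [F FT Foo] := sigma_finiteT (@lebesgue_row R n).
exists (fun i => S @^-1` F i).
  by rewrite -preimage_bigcup -FT preimage_setT.
move=> i; have [mF Fi] := Foo i; split; first exact: preimage_measurable.
rewrite /lebesgue_preimage -comp_preimage (_ : _ \o _ = id) ?preimage_id//.
exact/funext.
Qed.

HB.instance Definition _ := Measure_isSigmaFinite.Build _ _ _ lebesgue_preimage
  lebesgue_preimage_sigma_finite.

(** As T (x + S v) = T x + v, the image measure is translation invariant. A symmetric test set [B]
    of positive finite measure whose preimage is known then determines the factor by which [T]
    changes volume. *)
Lemma lebesgue_row_preimageE (SK : cancel S T) (A B : set V) :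
  measurable A -> measurable B -> (fun x : V => - x) @^-1` B = B ->
  (lebesgue_row n (T @^-1` A) * lebesgue_row n B =
   lebesgue_row n (T @^-1` B) * lebesgue_row n A)%E.
Proof.
move=> mA mB NB.
have hs (v : V) (D : set V) : measurable D ->
    lebesgue_preimage ((fun x => x + v) @^-1` D) = lebesgue_preimage D.
  move=> mD; rewrite /lebesgue_preimage.
  rewrite -[RHS](@lebesgue_row_shift _ n (S v)); last exact: preimage_measurable.
  by congr (lebesgue_row n _); apply/seteqP; split => x /=; rewrite TD SK.
by have := @shift_invariant_measureE R n lebesgue_preimage hs A B mA mB; rewrite NB.
Qed.

End bijection.

(** Test set for dilations: it is symmetric, and dilations map cubes to cubes of known volume. *)
Let cube (t : R) : set V := [set x | forall i, `[- t, t]%classic (x ord0 i)].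

Let mcube t : measurable (cube t).
Proof. exact: (measurable_row_box (A := fun=> `[- t, t]%classic)). Qed.

Let cubeN t : (fun x : V => - x) @^-1` cube t = cube t.
Proof.
by apply/seteqP; split => x /= xt i; have := xt i;
  rewrite /= mxE !in_itv/= => /andP[]; lra.
Qed.

Lemma lebesgue_row_cube t : 0 <= t ->
  lebesgue_row n [set x : V | forall i, `[- t, t]%classic (x ord0 i)] =
  ((2 * t) ^+ n)%:E.
Proof.
move=> t0; rewrite (lebesgue_row_box (A := fun=> `[- t, t]%classic))//.
rewrite (eq_bigr (fun=> (2 * t)%:E)) => [|i _].
  by rewrite prodEFin prodr_const card_ord.
rewrite lebesgue_measure_itv/= lte_fin.
have [tt|] := ltP (- t) t; first by rewrite -EFinB opprK mulr2n mulrDl mul1r.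
move=> tt; have -> : t = 0 by lra.
by rewrite mulr0.
Qed.

Lemma lebesgue_row_scale t (A : set V) : 0 < t -> measurable A ->
  lebesgue_row n ((fun x => t *: x) @^-1` A) = ((t ^- n)%:E * lebesgue_row n A)%E.
Proof.
move=> t0 mA.
have ms (c : R) : measurable_fun [set: V] (fun x : V => c *: x).
  by under eq_fun do rewrite -[_ *: _]add0r; exact: measurable_row_lin.
have tN0 : t != 0 by rewrite gt_eqF.
have := @lebesgue_row_preimageE _ (fun x => t^-1 *: x) (ms t) (ms t^-1) _ _ _
  A (cube 1) mA (mcube 1) (cubeN 1).
rewrite (_ : _ @^-1` cube 1 = cube t^-1); last first.
  apply/seteqP; split => x /= xt i; have := xt i; rewrite /= mxE !in_itv/= -!ler_norml.
    by rewrite normrM gtr0_norm// -(ler_pM2l t0 _ t^-1) divff.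
  by rewrite normrM gtr0_norm// -(ler_pM2l t0 _ t^-1) divff.
rewrite !lebesgue_row_cube ?invr_ge0 ?ltW// => H.
(* The factor [2 ^- n] cancels the volume of the test set [cube 1]. *)
have {H} /(congr1 (fun z => ((2 ^- n)%:E * z)%E)) :
  (lebesgue_row n ((fun x => t *: x) @^-1` A) * ((2 * 1) ^+ n)%:E =
   ((2 / t) ^+ n)%:E * lebesgue_row n A)%E.
  apply: H; [by move=> x; rewrite scalerA mulVf// scale1r|exact: scalerDr|].
  by move=> x; rewrite scalerA divff// scale1r.
rewrite mulr1 muleC -muleA -EFinM divff ?expf_neq0// mule1 => ->.
by rewrite muleA -EFinM exprMn mulrA mulVf ?expf_neq0// mul1r exprVn.
Qed.

(** The test set is the Euclidean unit ball, which a reflection maps to itself. Its exact volume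
    does not matter: comparison with cubes shows that it is finite and positive, so it cancels. *)
Lemma lebesgue_row_reflection (a : V) (A : set V) : dotp a a = 2 -> measurable A ->
  lebesgue_row n (reflection a @^-1` A) = lebesgue_row n A.
Proof.
move=> a2 mA.
pose B : set V := [set x | enorm x <= 1].
have mB : measurable B.
  rewrite (_ : B = @enorm R n @^-1` `]-oo, 1]%classic).
    exact: preimage_measurable measurable_enorm _.
  by apply/seteqP; split => x; rewrite /B /= in_itv.
have := @lebesgue_row_preimageE _ (reflection a) (measurable_reflection a)
  (measurable_reflection a) (reflectionK a2) _ (reflectionK a2) A B mA mB.
have -> : reflection a @^-1` B = B.
  by apply/seteqP; split => x; rewrite /B /= enorm_reflection.
have Boo : (lebesgue_row n B < +oo)%E.
  apply: (@le_lt_trans _ _ (lebesgue_row n (cube 1))).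
    apply: le_measure; rewrite ?inE// => x xB i /=.
    rewrite in_itv/= -ler_norml; exact: le_trans (coord_le_enorm _ _) xB.
  by rewrite lebesgue_row_cube// ltry.
(* In the cube of half-side 1/(n+1), each squared coordinate is at most 1/(n+1), so the sum of the n
   squares is below 1; n+1 keeps the side positive even for n = 0. *)
have B0 : (0 < lebesgue_row n B)%E.
  apply: (@lt_le_trans _ _ (lebesgue_row n (cube n.+1%:R^-1))).
    by rewrite lebesgue_row_cube// lte_fin exprn_gt0// mulr_gt0.
  apply: le_measure; rewrite ?inE// => x xB /=.
  rewrite /B /= /enorm -[leRHS]sqrtr1 ler_wsqrtr//.
  apply: (@le_trans _ _ (\sum_(i < n) n.+1%:R^-1)).
    apply: ler_sum => i _; rewrite -expr2 -[n.+1%:R^-1]mulr1.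
    have := xB i; rewrite /= in_itv/= -ler_norml => xi.
    rewrite -real_normK ?num_real// expr2.
    rewrite ler_pM// (le_trans xi)// invf_le1// ler1n//.
  rewrite sumr_const card_ord -[leLHS]mulr_natl ler_pdivrMr// mul1r ler_nat.
  exact: leqnSn.
move=> H; have {H} : (lebesgue_row n (reflection a @^-1` A) * lebesgue_row n B =
    lebesgue_row n A * lebesgue_row n B)%E.
  rewrite [RHS]muleC; apply: H.
    by move=> x y; rewrite !reflectionE// dotpDr scalerDl opprD addrACA.
  by apply/seteqP; split => x; rewrite /B /= -scaleN1r /enorm dotpZr dotpC dotpZr
    mulrA mulrNN mulr1 mul1r.
have Bf : lebesgue_row n B \is a fin_num by rewrite ge0_fin_numE// ltW.
move/(congr1 (fun z => (z * (fine (lebesgue_row n B))^-1%:E)%E)).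
rewrite -!muleA -{1 3}(fineK Bf) -EFinM divff ?mule1//.
by rewrite gt_eqF// fine_gt0// B0.
Qed.

End lebesgue_row_linear.

(** * Homogeneity and reflection invariance of the Dunkl measure *)

Section dunkl_measure_theory.
Context {R : realType} {N : nat}.
Local Notation V := 'rV[R]_N.
Variables (Phi P : {fset V}) (k : V -> R).

Lemma dunkl_weight_scale (t : R) (x : V) : 0 < t ->
  dunkl_weight P k (t *: x) = t `^ (2 * dunkl_gamma P k) * dunkl_weight P k x.
Proof.
move=> t0; rewrite /dunkl_weight /dunkl_gamma.
elim: (enum_fset P) => [|a s IH]; first by rewrite !big_nil mulr0 powRr0 mul1r.
rewrite !big_cons IH dotpZr normrM (gtr0_norm t0) powRM ?(ltW t0)// mulrDr.
by rewrite powRD ?(gt_eqF t0) ?implybT// mulrACA.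
Qed.

(** A reflection permutes all roots but need not preserve the positive ones. The square of the
    weight is a product over all of [Phi], because b and -b contribute equal factors; it is
    therefore invariant, and nonnegativity removes the square. *)
Lemma dunkl_weight_reflection (a x : V) : root_system Phi -> positive_subsystem Phi P ->
  multiplicity Phi k -> a \in Phi ->
  dunkl_weight P k (reflection a x) = dunkl_weight P k x.
Proof.
move=> hPhi [PhiE PNP] [_ kG] aPhi.
have dot2 b : b \in Phi -> dotp b b = 2.
  by move=> bPhi; rewrite -enorm_sqr (root_normalized hPhi).
have reflPhi b : b \in Phi -> reflection a b \in Phi.
  move=> bPhi; have : [set` Phi] (reflection a b).
    by rewrite -(root_reflection hPhi aPhi); exists b.
  by [].
have PPhi b : b \in P -> b \in Phi.
  by move=> bP; have : [set` Phi] b by rewrite PhiE; left.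
have kN b : b \in Phi -> k (- b) = k b.
  move=> bPhi; have -> : - b = reflection b b.
    by rewrite reflectionE ?dot2// scaler_nat mulr2n opprD addNKr.
  by apply: kG => //; exact: reflection_group_gen.
pose F x b := `|dotp b x| `^ (2 * k b).
have wE y : dunkl_weight P k y ^+ 2 = \prod_(b <- Phi) F y b.
  (* [Phi] is the disjoint union of [P] and [-P], so their enumerations agree up to a
     permutation. *)
  have -> : \prod_(b <- Phi) F y b = \prod_(b <- enum_fset P ++ map -%R P) F y b.
    apply: perm_big; apply: uniq_perm; first exact: fset_uniq.
      rewrite cat_uniq fset_uniq /= (map_inj_uniq (@oppr_inj _)) fset_uniq andbT.
      apply/hasPn => _ /mapP[b bP ->]; apply/negP => NbP.
      have : ([set` P] `&` [set - a | a in [set` P]]) (- b) by split=> //; exists b.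
      by rewrite PNP.
    move=> b; rewrite mem_cat; apply/idP/orP.
      move=> bPhi; have : [set` Phi] b by [].
      by rewrite PhiE => -[bP|[c cP <-]]; [left|right; apply: map_f].
    case=> [|/mapP[c cP ->]]; first exact: PPhi.
    by have : [set` Phi] (- c) by rewrite PhiE; right; exists c.
  rewrite big_cat big_map /= expr2; congr (_ * _).
  rewrite /dunkl_weight big_seq [RHS]big_seq; apply: eq_bigr => b bP.
  by rewrite /F kN ?PPhi// [dotp (- b) y]dotpC -scaleN1r dotpZr mulN1r normrN dotpC.
apply/eqP; rewrite -(@eqrXn2 _ 2) ?dunkl_weight_ge0// !wE; apply/eqP.
(* Reindexing by the reflection, which permutes [Phi]; self-adjointness then moves it from x to the
   root. *)
have -> : \prod_(b <- Phi) F x b = \prod_(b <- map (reflection a) Phi) F x b.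
  apply: perm_big; apply: uniq_perm; first exact: fset_uniq.
    rewrite map_inj_uniq ?fset_uniq//.
    by apply: inv_inj; apply: reflectionK; exact: dot2.
  move=> b; apply/idP/mapP => [bPhi|[c cPhi ->]]; last exact: reflPhi.
  by exists (reflection a b); rewrite ?reflPhi// reflectionK ?dot2.
rewrite big_map big_seq [RHS]big_seq; apply: eq_bigr => b bPhi.
rewrite /F dotp_reflection ?dot2//; congr (_ `^ (2 * _)).
by apply/esym/kG => //; exact: reflection_group_gen.
Qed.

(** Common source of both transformation rules: a dilation by t has c = t^(-N) and e = t^(2 gamma),
    a reflection has c = e = 1. *)
Lemma dunkl_measure_preimage (T : V -> V) (c e : R) (A : set V) :
  measurable_fun [set: V] T -> 0 <= c -> 0 < e ->
  (forall A, measurable A -> lebesgue_row N (T @^-1` A) = (c%:E * lebesgue_row N A)%E) ->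
  (forall x, dunkl_weight P k (T x) = e * dunkl_weight P k x) ->
  measurable A ->
  dunkl_measure P k (T @^-1` A) = ((c / e)%:E * dunkl_measure P k A)%E.
Proof.
move=> mT c0 e0 leb w mA.
have mw : measurable_fun [set: V] (fun x => (dunkl_weight P k x)%:E).
  by apply/measurable_EFinP; exact: measurable_dunkl_weight.
rewrite /dunkl_measure.
transitivity (\int[lebesgue_row N]_(x in T @^-1` A)
    ((e^-1)%:E * (dunkl_weight P k (T x))%:E))%E.
  by apply: eq_integral => x _; rewrite w -EFinM mulrA mulVf ?mul1r// gt_eqF.
rewrite ge0_integralZl//; last 4 first.
- exact: preimage_measurable.
- apply/measurable_EFinP/measurable_funTS.
  exact: (measurableT_comp (measurable_dunkl_weight P k)).
- by move=> x _; rewrite lee_fin dunkl_weight_ge0.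
- by rewrite lee_fin invr_ge0 ltW.
rewrite mulrC EFinM -muleA; congr (_ * _)%E.
have := @ge0_integral_pushforward _ _ _ _ R _ mT (lebesgue_row N) A
  (fun x => (dunkl_weight P k x)%:E) mA (measurable_funTS mw).
rewrite /= => <-; last by move=> x _; rewrite lee_fin dunkl_weight_ge0.
rewrite -(@ge0_integral_mscale _ _ _ _ _ _ (NngNum c0))//; last 2 first.
- exact: measurable_funTS.
- by move=> x _; rewrite lee_fin dunkl_weight_ge0.
by apply: eq_measure_integral => B mB _; exact: leb.
Qed.

Lemma ge0_integral_preimage (T : V -> V) (c : R) (f : V -> \bar R) :
  measurable_fun [set: V] T -> 0 <= c ->
  (forall A, measurable A ->
     dunkl_measure P k (T @^-1` A) = (c%:E * dunkl_measure P k A)%E) ->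
  measurable_fun [set: V] f -> (forall x, 0 <= f x)%E ->
  (\int[dunkl_measure P k]_x f (T x) = c%:E * \int[dunkl_measure P k]_x f x)%E.
Proof.
move=> mT c0 mu mf f0.
have := @ge0_integral_pushforward _ _ _ _ R _ mT (dunkl_measure P k) setT
  f measurableT mf (fun x _ => f0 x).
rewrite preimage_setT => <-.
rewrite -(@ge0_integral_mscale _ _ _ _ _ _ (NngNum c0))//.
by apply: eq_measure_integral => B mB _; exact: mu.
Qed.

Lemma dunkl_measure_scale (t : R) (A : set V) : 0 < t -> measurable A ->
  dunkl_measure P k ((fun x => t *: x) @^-1` A) =
  ((t `^ (- (N%:R + 2 * dunkl_gamma P k)))%:E * dunkl_measure P k A)%E.
Proof.
move=> t0 mA.
rewrite (@dunkl_measure_preimage _ (t ^- N) (t `^ (2 * dunkl_gamma P k)))//.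
- rewrite -powR_mulrn ?ltW// -!powRN -powRD ?opprD//.
  by rewrite (gt_eqF t0) implybT.
- by under eq_fun do rewrite -[_ *: _]add0r; apply: measurable_row_lin.
- by rewrite invr_ge0 exprn_ge0 ?ltW.
- exact: powR_gt0.
- by move=> B mB; exact: lebesgue_row_scale.
- by move=> x; rewrite dunkl_weight_scale.
Qed.

Lemma dunkl_measure_reflection (a : V) (A : set V) : root_system Phi ->
  positive_subsystem Phi P -> multiplicity Phi k -> a \in Phi -> measurable A ->
  dunkl_measure P k (reflection a @^-1` A) = dunkl_measure P k A.
Proof.
move=> hPhi hP hk aPhi mA.
rewrite (@dunkl_measure_preimage _ 1 1) ?divr1 ?mul1e//.
- exact: measurable_reflection.
- move=> B mB; rewrite mul1e; apply: lebesgue_row_reflection => //.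
  by rewrite -enorm_sqr (root_normalized hPhi).
- by move=> x; rewrite mul1r dunkl_weight_reflection.
Qed.

Lemma measurable_enorm_ball (r : R) : measurable [set x : V | enorm x <= r].
Proof.
rewrite (_ : [set x | _] = @enorm R N @^-1` `]-oo, r]%classic).
  exact: preimage_measurable measurable_enorm _.
by apply/seteqP; split => x; rewrite /= in_itv.
Qed.

(** On the ball, Cauchy-Schwarz bounds every factor of the weight, and the ball lies in a cube of
    finite volume. *)
Lemma dunkl_measure_ball_lty (r : R) : (forall a, a \in P -> 0 <= k a) -> 0 <= r ->
  (dunkl_measure P k [set x | enorm x <= r]%R < +oo)%E.
Proof.
move=> k0 r0; pose M := \prod_(a <- P) (enorm a * r) `^ (2 * k a).
have M0 : 0 <= M by apply: prodr_ge0 => a _; exact: powR_ge0.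
apply: (@le_lt_trans _ _ (\int[@lebesgue_row R N]_(x in [set x | enorm x <= r]%R) M%:E)%E).
  apply: ge0_le_integral.
  - exact: measurable_enorm_ball.
  - by move=> x _; rewrite lee_fin dunkl_weight_ge0.
  - by apply/measurable_EFinP/measurable_funTS; exact: measurable_dunkl_weight.
  - exact: measurable_cst.
  move=> x /= xr; rewrite lee_fin /dunkl_weight big_seq [leRHS]big_seq.
  apply: ler_prod => a aP; rewrite powR_ge0/=.
  rewrite ge0_ler_powR ?nnegrE ?mulr_ge0 ?k0 ?enorm_ge0//.
  by rewrite (le_trans (dotp_le a x))// ler_wpM2l ?enorm_ge0.
rewrite integral_cst; last exact: measurable_enorm_ball.
rewrite lte_mul_pinfty ?lee_fin//.
apply: (@le_lt_trans _ _
    (lebesgue_row N [set x : V | forall i, `[- r, r]%classic (x ord0 i)])).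
  apply: le_measure; rewrite ?inE.
  - exact: measurable_enorm_ball.
  - exact: (measurable_row_box (A := fun=> `[- r, r]%classic)).
  move=> x xB i /=.
  by rewrite in_itv/= -ler_norml; exact: le_trans (coord_le_enorm _ _) xB.
by rewrite lebesgue_row_cube// ltry.
Qed.

(** Allows the origin to be ignored in pointwise comparisons of powers of |x|. Positive dimension
    matters, as [lebesgue_row 0] is a Dirac mass at the origin. *)
Lemma dunkl_measure_set0 : (0 < N)%N -> dunkl_measure P k [set 0] = 0%E.
Proof.
move=> N0.
have E : [set (0 : V)] = [set x : V | forall i, [set 0 : R] (x ord0 i)].
  by apply/seteqP; split=> x /= => [-> i|x0]; [rewrite mxE|apply/rowP => i; rewrite mxE].
have m0 : measurable [set (0 : V)].
  rewrite E; exact: (measurable_row_box (A := fun=> [set 0])).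
have mu0 : lebesgue_row N [set (0 : V)] = 0%E.
  rewrite E (lebesgue_row_box (A := fun=> [set 0]))//.
  rewrite (bigD1 (Ordinal N0))//= lebesgue_measure_set1 mul0e//.
rewrite /dunkl_measure; apply: null_set_integral => //.
by apply/measurable_EFinP/measurable_funTS; exact: measurable_dunkl_weight.
Qed.

End dunkl_measure_theory.

(** * Measurability of continuous functions and the mean value theorem in coordinates *)

Section row_calculus.
Context {R : realType} {N : nat}.
Local Notation V := 'rV[R]_N.
Implicit Types (f g : V -> R) (x v : V).

Lemma row_norm_le c x : 0 <= c -> (forall i, `|x ord0 i| <= c) -> `|x| <= c.
Proof.
move=> c0 xc; rewrite [leLHS]mx_normrE; apply: bigmax_le => // -[i j] _ /=.
by rewrite ord1.
Qed.

Lemma coord_le_norm x i : `|x ord0 i| <= `|x|.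
Proof.
by rewrite [leRHS]mx_normrE; exact: (le_bigmax _ (fun ij => `|x ij.1 ij.2|) (ord0, i)).
Qed.

(** The sigma-algebra is given by coordinates rather than open sets. So [g] is obtained as the
    pointwise limit of [g \o a m], where [a m] rounds each coordinate down to a multiple of
    1/(m+1). *)
Lemma continuous_row_measurable g : continuous g -> measurable_fun [set: V] g.
Proof.
move=> cg.
pose a (m : nat) x : V := \row_i ((Num.floor (m.+1%:R * x ord0 i))%:~R / m.+1%:R).
apply: (@measurable_fun_cvg _ _ R setT (fun m => g \o a m)) => [m|x _].
  move=> _ Y mY; rewrite setTI.
  pose D (z : 'rV[int]_N) : set V :=
    [set x | forall i, [set s : R | Num.floor (m.+1%:R * s) = z ord0 i] (x ord0 i)].
  pose p (z : 'rV[int]_N) : V := \row_i ((z ord0 i)%:~R / m.+1%:R).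
  (* The preimage is the countable union of the grid cells [D z] whose corner [p z] is sent into
     [Y]. *)
  rewrite (_ : _ @^-1` Y = \bigcup_(z : 'rV[int]_N)
      (D z `&` [set _ | Y (g (p z))])); last first.
    apply/seteqP; split => x /=.
      move=> Yx; exists (\row_i Num.floor (m.+1%:R * x ord0 i)) => //; split => /= [i|].
        by rewrite mxE.
      by rewrite (_ : p _ = a m x)//; apply/rowP => i; rewrite !mxE.
    case=> z _ [/= Dz Yz]; rewrite (_ : a m x = p z)//.
    by apply/rowP => i; rewrite !mxE Dz.
  apply: countable_bigcupT_measurable => [|z]; first exact: countableP.
  apply: measurableI; last first.
    have [Yz|Yz] := pselect (Y (g (p z))).
      by rewrite (_ : [set _ | _] = setT)//; apply/seteqP; split.
    by rewrite (_ : [set _ | _] = set0)//; apply/seteqP; split.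
  apply: (measurable_row_box
    (A := fun i => [set s : R | Num.floor (m.+1%:R * s) = z ord0 i])) => i.
  rewrite (_ : [set s | _] =
    `[(z ord0 i)%:~R / m.+1%:R, (z ord0 i + 1)%:~R / m.+1%:R[%classic)//.
  apply/seteqP; split => s /=; rewrite in_itv/= ler_pdivrMr// ltr_pdivlMr// (mulrC s).
    by move=> <-; exact: floor_itv.
  by move=> /floor_def.
apply: (continuous_cvg _ (f := a^~ x) (h := g)); first exact: cg.
apply/cvgrPdist_le => e e0; near=> m.
apply: row_norm_le => [|i]; first exact: ltW.
rewrite !mxE; apply: (@le_trans _ _ (m.+1%:R^-1)).
  rewrite -[X in X - _](@mulfK _ m.+1%:R) ?pnatr_eq0// -mulrBl normrM.
  rewrite [X in _ * X]ger0_norm// ler_piMl//.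
  have /andP[] := floor_itv (m.+1%:R * x ord0 i).
  rewrite intrD (mulrC _ (x _ _)) => h1 h2; rewrite ger0_norm; lra.
apply/ltW; near: m; exact: (near_infty_natSinv_lt (PosNum e0)).
Unshelve. all: by end_near. Qed.

Lemma is_derive_line g x v (t : R) : (forall y, derivable g y v) ->
  is_derive t (1 : R) (fun s : R => g (x + s *: v)) ('D_v g (x + t *: v)).
Proof.
move=> dg.
have E : (fun h : R => h^-1 *:
    (((fun s : R => g (x + s *: v)) \o shift t) (h *: 1) - g (x + t *: v))) =
    (fun h : R => h^-1 *: ((g \o shift (x + t *: v)) (h *: v) - g (x + t *: v))).
  apply/funext => h /=; congr (_ *: (g _ - _)).
  by rewrite [h *: 1]mulr1 scalerDl addrCA.
have dgx := dg (x + t *: v).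
split; first by rewrite /derivable E.
by rewrite /derive E.
Qed.

Lemma MVT_line g x v (t : R) : (forall y, derivable g y v) ->
  exists2 s, `|s| <= `|t| & g (x + t *: v) - g x = t * 'D_v g (x + s *: v).
Proof.
move=> dg; pose h (s : R) := g (x + s *: v).
have dh (s : R) : is_derive s (1 : R) h ('D_v g (x + s *: v)).
  exact: is_derive_line.
have ch a b : {within `[a, b], continuous h}.
  apply: continuous_subspaceT => s; apply: differentiable_continuous.
  by apply/derivable1_diffP; have := dh s; case.
have h0 : g x = h 0 by rewrite /h scale0r addr0.
have [t0|t0] := leP 0 t.
  have [s] := MVT_segment t0 (fun s _ => dh s) (ch _ _).
  rewrite in_itv/= subr0 => /andP[s0 st] E; exists s; last by rewrite h0 mulrC -E.
  by rewrite !ger0_norm.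
have [s] := MVT_segment (ltW t0) (fun s _ => dh s) (ch _ _).
rewrite in_itv/= sub0r => /andP[st s0] E; exists s.
  by rewrite !ler0_norm ?lerN2// ltW.
by rewrite h0 -[LHS]opprB E mulrN opprK mulrC.
Qed.

(* Telescoping along x + sum_(j < m) v_j e_j, m = 0 .. N. *)
Lemma MVT_row g x v : (forall (i : 'I_N) y, derivable g y (delta_mx ord0 i : V)) ->
  exists2 xi : 'I_N -> V, (forall i, `|xi i - x| <= `|v|) &
    g (x + v) - g x = \sum_i v ord0 i * partial i g (xi i).
Proof.
move=> dg; pose y (m : nat) : V := x + \row_j (if (j < m)%N then v ord0 j else 0).
have yS (i : 'I_N) : y i.+1 = y i + v ord0 i *: delta_mx ord0 i.
  apply/rowP => j; rewrite !mxE eqxx/= ltnS leq_eqVlt -addrA; congr (_ + _).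
  have [->|ji] := eqVneq j i; first by rewrite eqxx ltnn mulr1 add0r.
  have -> : (val j == val i) = false by apply/negbTE.
  by rewrite /= mulr0 addr0.
(* A sigma type instead of an existential, so that the intermediate points form a function of
   [i]. *)
have H i : {s : R | `|s| <= `|v ord0 i| &
    g (y i.+1) - g (y i) = v ord0 i * partial i g (y i + s *: delta_mx ord0 i)}.
  apply/cid2; rewrite yS; exact: MVT_line.
exists (fun i : 'I_N => y i + s2val (H i) *: delta_mx ord0 i) => [i|].
  case: (H i) => s /= sv _; rewrite /y -[x + _ + _]addrA addrAC subrr add0r.
  apply: row_norm_le => // j; rewrite !mxE eqxx/=.
  have [->|ji] := eqVneq j i.
    by rewrite ltnn add0r mulr1 (le_trans sv)// coord_le_norm.
  by rewrite mulr0 addr0; case: ifPn => _; rewrite ?normr0 ?coord_le_norm.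
transitivity (\sum_(i < N) (g (y i.+1) - g (y i))).
  rewrite -(big_mkord xpredT (fun i => g (y i.+1) - g (y i))) telescope_sumr//.
  congr (g _ - g _).
    by apply/rowP => j; rewrite !mxE ltn_ord.
  by apply/rowP => j; rewrite !mxE ltn0 addr0.
by apply: eq_bigr => i _; case: (H i).
Qed.

End row_calculus.

(** * Test functions, the Euler operator and the Dunkl gradient *)

Section test_functions.
Context {R : realType} {N : nat}.
Local Notation V := 'rV[R]_N.
Implicit Types (f g : V -> R) (x v : V).

Definition euler f x : R := \sum_i x ord0 i * partial i f x.

Lemma test_function_support f : test_function f ->
  exists2 r : R, 0 < r & forall x, r < `|x| -> f x = 0.
Proof.
move=> [_ /compact_bounded[M [_ HM]]].
exists (Num.max M 0 + 1) => [|x xM].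
  by rewrite ltr_wpDl// le_max lexx orbT.
apply/eqP; apply: contraTT xM => fx; rewrite -leNgt.
apply: HM; first by rewrite ltr_pwDr// le_max lexx.
exact: subset_closure.
Qed.

Lemma partial_support g (r : R) i : (forall x, r < `|x| -> g x = 0) ->
  forall x, r < `|x| -> partial i g x = 0.
Proof.
move=> gr x rx; rewrite /partial (@near_eq_derive _ _ _ g (cst 0)) ?derive_cst//.
have : \forall y \near x, r < `|y|.
  have := @norm_continuous _ _ x.
  by move=> /(_ [set s | r < s]); apply; exact: lt_nbhsr.
by apply: filterS => y /gr.
Qed.

Lemma bounded_of_support g (r : R) : continuous g -> (forall x, r < `|x| -> g x = 0) ->
  exists2 M : R, 0 <= M & forall x, `|g x| <= M.
Proof.
move=> cg gr; pose B : set V := [set x | `|x| <= r].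
have cB : compact B.
  apply: bounded_closed_compact.
    exists r; split; first exact: num_real.
    by move=> s rs x /= xr; rewrite (le_trans xr)// ltW.
  rewrite (_ : B = (fun x => `|x|) @^-1` [set s | s <= r])//.
  apply: closed_comp; last exact: closed_le.
  by move=> x _; exact: norm_continuous.
have /compact_bounded[M [_ HM]] : compact (g @` B).
  by apply: continuous_compact => //; exact: continuous_subspaceT.
exists (Num.max M 0 + 1) => [|x].
  by rewrite addr_ge0// le_max lexx orbT.
have [rx|xr] := ltP r `|x|.
  by rewrite gr// normr0 addr_ge0// le_max lexx orbT.
apply: HM; last by exists x.
by rewrite ltr_pwDr// le_max lexx.
Qed.

Lemma smooth_continuous f : smooth f -> continuous f.
Proof. by move=> /(_ [::])[]. Qed.

Lemma smooth_partial_continuous f i : smooth f -> continuous (partial i f).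
Proof. by move=> /(_ [:: i])[]. Qed.

Lemma measurable_euler f : smooth f -> measurable_fun [set: V] (euler f).
Proof.
move=> sf; apply: measurable_sum => i; apply: measurable_funM.
  exact: measurable_coord.
exact: (continuous_row_measurable (@smooth_partial_continuous f i sf)).
Qed.

Lemma euler_support f (r : R) : (forall x, r < `|x| -> f x = 0) ->
  forall x, r < `|x| -> euler f x = 0.
Proof.
move=> fr x rx; rewrite /euler big1// => i _.
by rewrite (partial_support i fr)// mulr0.
Qed.

(** Second-order Taylor bound, uniform in x: the mean value theorem is applied to f between x and (1
    + t) x, then to its partial derivatives. *)
Lemma dilation_estimate f (r : R) : smooth f -> 0 < r -> (forall x, r < `|x| -> f x = 0) ->
  exists2 K : R, 0 <= K & forall (t : R) x, 0 <= t ->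
    `|f ((1 + t) *: x) - f x - t * euler f x| <= K * t ^+ 2.
Proof.
move=> sf r0 fr.
have /choice[M HM] : forall ij : 'I_N * 'I_N, exists M : R, 0 <= M /\
    forall x, `|partial ij.1 (partial ij.2 f) x| <= M.
  move=> ij.
  have [M M0 HM] := @bounded_of_support (partial ij.1 (partial ij.2 f)) r
    (sf [:: ij.1; ij.2]).1 (partial_support _ (partial_support _ fr)).
  by exists M.
pose M1 := \sum_i \sum_j M (i, j).
have M10 : 0 <= M1.
  apply: sumr_ge0 => i _; apply: sumr_ge0 => j _.
  by have [] := HM (i, j).
(* Only the bounds [M (j, i)] occur here; the rest of the double sum is nonnegative, so [M1] serves
   for every i. *)
have lip i x v : `|partial i f (x + v) - partial i f x| <= `|v| * M1.
  have [xi _ ->] := MVT_row x v (sf [:: i]).2.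
  rewrite (le_trans (ler_norm_sum _ _ _))// /M1.
  rewrite [in leRHS]exchange_big/= [in leRHS](bigD1 i)//=.
  rewrite mulrDr -[leLHS]addr0 lerD//.
    rewrite mulr_sumr; apply: ler_sum => j _; rewrite normrM ler_pM ?coord_le_norm//.
    exact: (HM (j, i)).2.
  apply: mulr_ge0 => //; apply: sumr_ge0 => j _; apply: sumr_ge0 => l _.
  by have [] := HM (l, j).
(* One term per coordinate; one factor r bounds the coordinate of x, the other comes from the
   distance t |x| of the intermediate points from x. *)
have K0 : 0 <= N%:R * r ^+ 2 * M1 by rewrite mulr_ge0// mulr_ge0// sqr_ge0.
exists (N%:R * r ^+ 2 * M1) => // t x t0.
rewrite scalerDl scale1r.
(* For t >= 0 the point (1 + t) x stays outside the support when x is outside, so all three terms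
   vanish. *)
have [rx|xr] := ltP r `|x|.
  rewrite (euler_support fr)// (fr x)// fr ?subr0 ?mulr0 ?normr0 ?subrr ?normr0.
    exact: mulr_ge0 K0 (sqr_ge0 t).
  rewrite -[x in x + _]scale1r -scalerDl normrZ ger0_norm ?addr_ge0//.
  by rewrite (lt_le_trans rx)// ler_peMl// lerDl.
have [xi Hxi ->] := MVT_row x (t *: x) (sf [::]).2.
rewrite /euler mulr_sumr -sumrB (le_trans (ler_norm_sum _ _ _))//.
rewrite (_ : N%:R * _ * _ * _ = \sum_(i < N) (t * r) * (t * r * M1)); last first.
  by rewrite sumr_const card_ord -mulr_natl; ring.
apply: ler_sum => i _; rewrite mxE.
rewrite [X in `|X|](_ : _ =
  (t * x ord0 i) * (partial i f (xi i) - partial i f x)); last by ring.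
rewrite normrM ler_pM//.
  rewrite normrM ger0_norm// ler_wpM2l//.
  exact: le_trans (coord_le_norm _ _) xr.
have := lip i x (xi i - x); rewrite [x + _]addrC subrK => /le_trans; apply.
by rewrite ler_wpM2r// (le_trans (Hxi i))// normrZ ger0_norm// ler_wpM2l.
Qed.

(** Summing x_i a_i over i gives <a, x>, which cancels the denominator. Where <a, x> = 0 the
    reflection fixes x and both sides of the cancellation are 0, so the identity holds at every
    point. *)
Lemma euler_dunkl P k f x : (forall a, a \in P -> dotp a a = 2) ->
  euler f x = dotp x (dunkl_grad P k f x) - \sum_(a <- P) k a * (f x - f (reflection a x)).
Proof.
move=> P2; apply/esym/eqP; rewrite subr_eq; apply/eqP.
rewrite /dotp; under eq_bigr do rewrite !mxE /dunkl_op mulrDr.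
rewrite big_split/=; congr (_ + _).
under eq_bigr do rewrite mulr_sumr.
rewrite exchange_big/= big_seq [RHS]big_seq; apply: eq_bigr => a aP.
transitivity (k a * (dotp a x * ((f x - f (reflection a x)) / dotp a x))).
  by rewrite /dotp mulr_suml mulr_sumr; apply: eq_bigr => i _; ring.
have [ax0|ax0] := eqVneq (dotp a x) 0; last by rewrite [dotp a x * _]mulrC divfK.
by rewrite ax0 mul0r reflectionE ?P2// ax0 scale0r subr0 subrr.
Qed.

(** Reduces to real powers, which agree with the inverse only on nonnegative numbers; the factor [s]
    carries the sign, and at 0 both sides are 0. *)
Lemma measurable_inv : measurable_fun [set: R] (fun s : R => s^-1).
Proof.
have -> : (fun s : R => s^-1) = (fun s => s * (s * s) `^ (- 1)).
  apply/funext => s; rewrite powR_inv1 -?expr2 ?sqr_ge0//.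
  have [->|s0] := eqVneq s 0; first by rewrite invr0 mul0r.
  by rewrite expr2 invfM mulrA divff// mul1r.
apply: measurable_funM => //.
by apply: (measurableT_comp (measurable_powR _)); exact: measurable_funM.
Qed.

Lemma measurable_dunkl_grad P k f : smooth f ->
  measurable_fun [set: V] (fun x => enorm (dunkl_grad P k f x)).
Proof.
move=> sf.
have mf := continuous_row_measurable (@smooth_continuous f sf).
apply: (measurableT_comp measurable_enorm).
apply: measurable_rowP => i; under eq_fun do rewrite mxE.
apply: measurable_funD.
  exact: (continuous_row_measurable (@smooth_partial_continuous f i sf)).
apply: measurable_sum => a; apply: measurable_funM => //.
apply: measurable_funM; last first.
  exact: (measurableT_comp measurable_inv (measurable_dotp a)).
apply: measurable_funB => //.
exact: (measurableT_comp mf (measurable_reflection a)).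
Qed.

End test_functions.

(** * Norms with respect to the Dunkl measure *)

Section dunkl_norm_theory.
Context {R : realType} {N : nat}.
Local Notation V := 'rV[R]_N.
Variables (P : {fset V}) (k : V -> R) (p : R).
Hypothesis p0 : 0 < p.
Implicit Types f g h : V -> R.

Lemma dunkl_normE g :
  dunkl_norm P k p g = ((\int[dunkl_measure P k]_x (`|g x| `^ p)%:E) `^ p^-1)%E.
Proof. by rewrite /dunkl_norm unlock. Qed.

Lemma measurable_norm_powR g : measurable_fun [set: V] g ->
  measurable_fun [set: V] (fun x => (`|g x| `^ p)%:E).
Proof.
move=> mg; apply/measurable_EFinP.
by apply: (measurableT_comp (measurable_powR _)); exact: measurableT_comp.
Qed.

Lemma dunkl_norm_ge0 g : (0 <= dunkl_norm P k p g)%E.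
Proof. exact: Lnorm_ge0. Qed.

Lemma le_dunkl_norm g h : measurable_fun [set: V] g -> measurable_fun [set: V] h ->
  {ae dunkl_measure P k, forall x, `|g x| <= `|h x|} ->
  (dunkl_norm P k p g <= dunkl_norm P k p h)%E.
Proof.
move=> mg mh gh; rewrite !dunkl_normE.
have I0 f : (0 <= \int[dunkl_measure P k]_x (`|f x| `^ p)%:E)%E.
  by apply: integral_ge0 => x _; rewrite lee_fin powR_ge0.
apply: gt0_ler_poweR; rewrite ?invr_ge0 ?(ltW p0)// ?in_itv/= ?leey ?andbT ?I0//.
apply: ae_ge0_le_integral => //; [exact: measurable_norm_powR|
  exact: measurable_norm_powR|].
apply: filterS gh => x gh _.
by rewrite lee_fin ge0_ler_powR ?(ltW p0)// ?nnegrE.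
Qed.

Lemma dunkl_normZ (c : R) g : 0 <= c -> measurable_fun [set: V] g ->
  dunkl_norm P k p (fun x => c * g x) = (c%:E * dunkl_norm P k p g)%E.
Proof.
move=> c0 mg; rewrite !dunkl_normE.
under eq_integral do rewrite normrM ger0_norm// powRM// EFinM.
rewrite ge0_integralZl//; [|exact: measurable_norm_powR|by move=> *; rewrite lee_fin powR_ge0].
rewrite poweRM ?lee_fin ?powR_ge0//; last first.
  by apply: integral_ge0 => x _; rewrite lee_fin powR_ge0.
by rewrite poweR_EFin -powRrM divff ?gt_eqF// powRr1.
Qed.

Lemma dunkl_norm_comp (T : V -> V) (c : R) g :
  measurable_fun [set: V] T -> 0 <= c ->
  (forall A, measurable A ->
     dunkl_measure P k (T @^-1` A) = (c%:E * dunkl_measure P k A)%E) ->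
  measurable_fun [set: V] g ->
  dunkl_norm P k p (g \o T) = ((c `^ p^-1)%:E * dunkl_norm P k p g)%E.
Proof.
move=> mT c0 mu mg; rewrite !dunkl_normE.
rewrite (@ge0_integral_preimage _ _ _ _ T c (fun x => (`|g x| `^ p)%:E))//.
- rewrite poweRM ?lee_fin ?poweR_EFin//.
  by apply: integral_ge0 => x _; rewrite lee_fin powR_ge0.
- exact: measurable_norm_powR.
Qed.

(** The bound is kept linear in [M], with a factor depending only on the ball, since it is also
    applied to a Taylor remainder of size t^2. *)
Lemma dunkl_norm_bounded_lty (M r : R) g : (forall a, a \in P -> 0 <= k a) ->
  measurable_fun [set: V] g -> 0 <= r -> 0 <= M ->
  (forall x, `|g x| <= M) -> (forall x, r < enorm x -> g x = 0) ->
  (dunkl_norm P k p g <= M%:E * dunkl_norm P k p \1_[set x | (enorm x <= r)%R])%E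
  /\ (dunkl_norm P k p (\1_[set x | (enorm x <= r)%R] : V -> R) < +oo)%E.
Proof.
move=> k0 mg r0 M0 gM gr; set B := [set x | _].
have mB : measurable B by exact: measurable_enorm_ball.
split.
  rewrite -dunkl_normZ//.
  apply: le_dunkl_norm => //; first exact: measurable_funM.
  apply: aeW => x.
  rewrite indicE; have [xB|] := boolP (x \in B).
    by rewrite mulr1 (le_trans (gM x))// ler_norm.
  by rewrite notin_setE => /negP; rewrite -ltNge => /gr ->; rewrite normr0.
rewrite dunkl_normE poweR_lty//.
rewrite (eq_integral (fun x => (\1_B x)%:E)) => [|x _].
  by rewrite integral_indic// setIT; exact: dunkl_measure_ball_lty.
by rewrite indicE; case: (x \in B); rewrite ?normr1 ?powR1 ?normr0 ?powR0// gt_eqF.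
Qed.

Lemma dunkl_norm_sum (p1 : 1 <= p) (I : Type) (s : seq I) (F : I -> V -> R) :
  (forall i, measurable_fun [set: V] (F i)) ->
  (dunkl_norm P k p (fun x => \sum_(i <- s) F i x)%R <=
   \sum_(i <- s) dunkl_norm P k p (F i))%E.
Proof.
move=> mF; elim: s => [|i s IH].
  rewrite big_nil dunkl_normE; under eq_integral do rewrite big_nil normr0 powR0 ?gt_eqF//.
  by rewrite integral0 poweR0r// invr_neq0 ?gt_eqF.
rewrite big_cons; apply: (@le_trans _ _
    (dunkl_norm P k p (F i) + dunkl_norm P k p (fun x => \sum_(i <- s) F i x)%R)%E).
  rewrite [leLHS](_ : _ = dunkl_norm P k p (F i \+ (fun x => \sum_(i <- s) F i x))).
    by apply: minkowski_EFin => //; apply: measurable_sum.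
  by congr dunkl_norm; apply/funext => x; rewrite big_cons.
exact: leeD2l.
Qed.

End dunkl_norm_theory.

(** * The Hardy inequality for the Dunkl gradient *)

Section hardy.
Context {R : realType} {N : nat}.
Local Notation V := 'rV[R]_N.
Variables (Phi P : {fset V}) (k : V -> R).
Hypotheses (hPhi : root_system Phi) (hP : positive_subsystem Phi P)
  (hk : multiplicity Phi k).
Variable p : R.
Hypothesis p1 : 1 < p.
Implicit Types f : V -> R.
Local Notation gamma := (dunkl_gamma P k).
Local Notation norm f := (dunkl_norm P k p f%R).

Let p0 : 0 < p. Proof. exact: lt_trans p1. Qed.

Lemma positive_root a : a \in P -> a \in Phi.
Proof. by case: hP => PhiE _ aP; have : [set` Phi] a by rewrite PhiE; left. Qed.

Lemma root_sqr a : a \in P -> dotp a a = 2.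
Proof.
by move=> /positive_root aPhi; rewrite -enorm_sqr (root_normalized hPhi).
Qed.

Lemma multiplicity_ge0 a : a \in P -> 0 <= k a.
Proof. by move=> /positive_root; exact: hk.1. Qed.

(** The truncation makes the weighted norm of a test function finite before any Hardy inequality is
    known, and it depends on |x| only, so reflections preserve it. *)
Definition reg_inv (e : R) (x : V) : R := (Num.max (enorm x) e)^-1.

Lemma measurable_reg_inv e : measurable_fun [set: V] (reg_inv e).
Proof.
apply: (measurableT_comp measurable_inv).
by apply: measurable_maxr => //; exact: measurable_enorm.
Qed.

Lemma reg_inv_ge0 e x : 0 <= reg_inv e x.
Proof. by rewrite invr_ge0 le_max enorm_ge0. Qed.

Lemma reg_inv_le e x : 0 < e -> reg_inv e x <= e^-1.
Proof. by move=> e0; rewrite lef_pV2 ?posrE ?lt_max ?e0 ?orbT// le_max lexx orbT. Qed.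

(** Substitute for homogeneity of degree -1: max(l |x|, e) <= l max(|x|, e) when l >= 1. *)
Lemma reg_inv_scale e (l : R) x : 0 < e -> 1 <= l ->
  reg_inv e x <= l * reg_inv e (l *: x).
Proof.
move=> e0 l1; have l0 : 0 < l by exact: lt_le_trans l1.
have m0 y : 0 < Num.max (enorm y) e by rewrite lt_max e0 orbT.
rewrite /reg_inv ler_pdivlMr// ler_pdivrMl// enormZ ?(ltW l0)//.
rewrite ge_max (mulrC l) ler_wpM2r ?(ltW l0) ?le_max ?lexx//=.
by rewrite -[leLHS]mulr1 ler_pM// ?(ltW e0)// le_max lexx orbT.
Qed.

Lemma enorm_le_norm (x : V) : enorm x <= Num.sqrt N%:R * `|x|.
Proof.
rewrite -(normr_id x) -sqrtr_sqr -sqrtrM// ler_wsqrtr//.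
rewrite mulr_natl -[N in _ *+ N]card_ord -sumr_const ler_sum// => i _.
by rewrite -expr2 -real_normK ?num_real// ler_sqr ?nnegrE// coord_le_norm.
Qed.

Lemma dunkl_normN f : norm (\- f) = norm f.
Proof.
by rewrite !dunkl_normE; congr (_ `^ _)%E; apply: eq_integral => x _; rewrite normrN.
Qed.

(* From A <= (1 + t)^(-kappa) A + t D + K t^2 one gets kappa A <= D as t -> 0. *)
Lemma rate_bound (kappa A D K : R) : 0 < kappa -> 0 <= A -> 0 <= D -> 0 <= K ->
  (forall t : R, 0 < t <= 1 -> A <= (1 + t) `^ (- kappa) * A + t * D + K * t ^+ 2) ->
  kappa * A <= D.
Proof.
move=> kp A0 D0 K0 H.
(* Multiplying the hypothesis by [1 + t * (1 + kappa)] removes the power by [pw]; then (1 + t) A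
   cancels and t divides out. *)
have H1 (t : R) : 0 < t <= 1 -> kappa * A <= (1 + t * (1 + kappa)) * (D + K * t).
  move=> /andP[t0 t1]; have := H t; rewrite t0 t1 => /(_ isT) Ht.
  have q0 : 0 < 1 + t by lra.
  (* This is ln (1 + u) <= u at u = -t / (1 + t). *)
  have lnt : t <= (1 + t) * ln (1 + t).
    have E : (1 + t)^-1 = 1 + (- t / (1 + t)) by field; rewrite gt_eqF.
    have tl : t / (1 + t) < 1 by rewrite ltr_pdivrMr// mul1r; lra.
    have : ln (1 + (- t / (1 + t))) <= - t / (1 + t) by apply: le_ln1Dx; rewrite mulNr ltrN2.
    rewrite -E lnV ?posrE// mulNr lerN2 ler_pdivrMr// mulrC//.
  have pw : (1 + t) `^ (- kappa) * (1 + t * (1 + kappa)) <= 1 + t.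
    have -> : (1 + t) `^ (- kappa) = (expR (kappa * ln (1 + t)))^-1.
      by rewrite /powR gt_eqF// mulNr expRN.
    rewrite mulrC ler_pdivrMr ?expR_gt0//.
    have := expR_ge1Dx (kappa * ln (1 + t)).
    nra.
  have s0 : 0 <= 1 + t * (1 + kappa) by nra.
  have h1 := ler_wpM2r s0 Ht; have h2 := ler_wpM2r A0 pw.
  rewrite -(ler_pM2l t0); set u := _ `^ _ in h1 h2; lra.
apply/ler_addgt0Pr => e e0.
(* Coefficient of t in the expanded right-hand side of [H1], using t^2 <= t; the added 1 makes [C]
   positive. *)
pose C := (1 + kappa) * D + K * (2 + kappa) + 1.
have C0 : 0 < C by rewrite /C; nra.
pose t := Num.min 1 (e / C).
have t0 : 0 < t by rewrite lt_min ltr01 divr_gt0.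
have t1 : t <= 1 by rewrite ge_min lexx.
have te : t * C <= e by rewrite -ler_pdivlMr// ge_min lexx orbT.
apply: (le_trans (H1 t _)); first by rewrite t0 t1.
suff : (1 + t * (1 + kappa)) * (D + K * t) <= D + t * C by lra.
have kK : 0 <= (1 + kappa) * K by nra.
have tt : t * t <= t by rewrite ler_piMl// ltW.
have := ler_wpM2r kK tt; rewrite /C; lra.
Qed.

Lemma regularized_radial_bound f (e : R) : test_function f -> 0 < e ->
  p < N%:R + 2 * gamma ->
  (norm (fun x => reg_inv e x * f x) < +oo)%E /\
  (((N%:R + 2 * gamma - p) / p)%:E * norm (fun x => reg_inv e x * f x)
   <= norm (fun x => reg_inv e x * euler f x))%E.
Proof.
move=> tf e0 pQ; have [sf _] := tf.
have [r r0 fr] := test_function_support tf.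
have [M M0 fM] := bounded_of_support (@smooth_continuous _ _ f sf) fr.
have [K K0 Hd] := dilation_estimate sf r0 fr.
have mf := continuous_row_measurable (@smooth_continuous _ _ f sf).
have mE := measurable_euler sf.
have mw := measurable_reg_inv e.
(* Euclidean radius of a ball containing the sup-norm ball of radius r. *)
pose r1 := Num.sqrt N%:R * r; have r10 : 0 <= r1 by rewrite mulr_ge0// ltW.
have r1x (x : V) : r1 < enorm x -> r < `|x|.
  move=> rx; rewrite ltNge; apply/negP => xr; move: rx; rewrite ltNge => /negP; apply.
  by rewrite (le_trans (enorm_le_norm x))// ler_wpM2l.
set g := fun x => reg_inv e x * f x.
have mg : measurable_fun [set: V] g by exact: measurable_funM.
have e10 : 0 <= e^-1 by rewrite invr_ge0 ltW.
have bnd (h : V -> R) (M' : R) :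
    measurable_fun [set: V] h -> 0 <= M' -> (forall x, `|h x| <= M') ->
    (forall x, r1 < enorm x -> h x = 0) ->
    (norm (fun x => reg_inv e x * h x)%R <=
     (e^-1 * M')%:E * norm \1_[set x | (enorm x <= r1)%R])%E /\
    (norm (\1_[set x | (enorm x <= r1)%R] : V -> R) < +oo)%E.
  move=> mh M'0 hM' hr; apply: dunkl_norm_bounded_lty => //.
  - exact: multiplicity_ge0.
  - exact: measurable_funM.
  - exact: mulr_ge0.
  - by move=> x; rewrite normrM ger0_norm ?reg_inv_ge0// ler_pM ?reg_inv_ge0 ?reg_inv_le.
  - by move=> x /hr ->; rewrite mulr0.
have [gb I1] := bnd f M mf M0 fM (fun x rx => fr _ (r1x _ rx)).
set I := norm (\1_[set x : V | (enorm x <= r1)%R] : V -> R) in gb I1 bnd.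
have I0 : (0 <= I)%E by exact: dunkl_norm_ge0.
have goo : (norm g < +oo)%E.
  by apply: (le_lt_trans gb); rewrite lte_mul_pinfty// lee_fin mulr_ge0.
split=> //.
set D := norm (fun x => reg_inv e x * euler f x).
have D0 : (0 <= D)%E by exact: dunkl_norm_ge0.
have [->|Dy] := eqVneq D +oo%E; first by rewrite leey.
have Dfin : D \is a fin_num by rewrite ge0_fin_numE// ltey.
have g0 : (0 <= norm g)%E by exact: dunkl_norm_ge0.
have gfin : norm g \is a fin_num by rewrite ge0_fin_numE.
have Ifin : I \is a fin_num by rewrite ge0_fin_numE.
rewrite -(fineK gfin) -(fineK Dfin) -EFinM lee_fin.
(* The Taylor remainder is at most K t^2 and supported in the ball of radius [r1]; the weight adds
   the factor 1/e. *)
apply: (@rate_bound _ _ _ (e^-1 * K * fine I)).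
- by rewrite divr_gt0// subr_gt0.
- exact: fine_ge0.
- exact: fine_ge0.
- by rewrite mulr_ge0 ?mulr_ge0 ?fine_ge0.
move=> t /andP[t0 t1].
have t10 : 0 < 1 + t by lra.
pose h x := f ((1 + t) *: x) - f x - t * euler f x.
have mS : measurable_fun [set: V] (fun x : V => (1 + t) *: x).
  by under eq_fun do rewrite -[_ *: _]add0r; apply: measurable_row_lin.
have mfS : measurable_fun [set: V] (fun x : V => f ((1 + t) *: x)).
  exact: measurableT_comp mf mS.
have mh : measurable_fun [set: V] h.
  by apply: measurable_funB; [exact: measurable_funB|exact: measurable_funM].
have [hb _] : (norm (fun x => reg_inv e x * h x) <=
    (e^-1 * (K * t ^+ 2))%:E * I)%E /\ (I < +oo)%E.
  apply: bnd => //.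
  - exact: mulr_ge0 K0 (sqr_ge0 t).
  - by move=> x; apply: Hd; exact: ltW.
  - move=> x /r1x rx; rewrite /h (euler_support fr)// (fr x)// fr ?subr0 ?mulr0 ?subr0//.
    by rewrite normrZ gtr0_norm// (lt_le_trans rx)// ler_peMl// lerDl ltW.
(* The exponent is 1 from [reg_inv_scale] plus -(N + 2 gamma)/p from the scaling of the measure. *)
have dil : (norm (fun x => reg_inv e x * f ((1 + t) *: x)) <=
    ((1 + t) `^ (- ((N%:R + 2 * gamma - p) / p)))%:E * norm g)%E.
  apply: (@le_trans _ _ (norm (fun x => (1 + t) * (g \o (fun x => (1 + t) *: x)) x))).
    apply: le_dunkl_norm => //.
    - exact: measurable_funM.
    - by apply: measurable_funM => //; exact: measurableT_comp mg mS.
    apply: aeW => x; rewrite /g /= mulrA !normrM ler_wpM2r// -normrM.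
    rewrite !ger0_norm ?mulr_ge0 ?reg_inv_ge0 ?(ltW t10)//.
    by rewrite reg_inv_scale// lerDl (ltW t0).
  rewrite dunkl_normZ//; [|exact: ltW|exact: measurableT_comp mg mS].
  rewrite (@dunkl_norm_comp _ _ _ _ _ _ ((1 + t) `^ (- (N%:R + 2 * gamma))))//; last 2 first.
  - exact: powR_ge0.
  - by move=> A mA; exact: dunkl_measure_scale.
  rewrite muleA -EFinM -powRrM -{1}(@powRr1 _ (1 + t)) ?(ltW t10)// -powRD.
    rewrite (_ : 1 + - (N%:R + 2 * gamma) / p = - ((N%:R + 2 * gamma - p) / p))//.
    by field; rewrite gt_eqF.
  by rewrite (gt_eqF t10) implybT.
(* By definition of [h], [g] is the dilated term [u0] minus the first-order term [u1] minus the
   remainder [u2]. *)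
pose u0 x := reg_inv e x * f ((1 + t) *: x).
pose u1 x := t * (reg_inv e x * euler f x).
pose u2 x := reg_inv e x * h x.
have mu0 : measurable_fun [set: V] u0 by exact: measurable_funM.
have mu1 : measurable_fun [set: V] u1.
  by apply: measurable_funM => //; exact: measurable_funM.
have mu2 : measurable_fun [set: V] u2 by exact: measurable_funM.
have tri : (norm g <= norm u0 + (t%:E * D + norm u2))%E.
  rewrite -dunkl_normZ//; [|exact: ltW|exact: measurable_funM].
  have -> : g = u0 \+ (\- (u1 \+ u2)).
    by apply/funext => x; rewrite /g /h /u0 /u1 /u2 /h /=; ring.
  apply: (@le_trans _ _ (norm u0 + norm (\- (u1 \+ u2)))%E).
    apply: minkowski_EFin => //; last exact: ltW.
    by apply: measurableT_comp => //; exact: measurable_funD.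
  by apply: leeD2l; rewrite dunkl_normN; apply: minkowski_EFin => //; exact: ltW.
rewrite -lee_fin fineK// !EFinD.
apply: (le_trans tri); rewrite -addeA; apply: leeD; first by rewrite EFinM fineK.
apply: leeD; first by rewrite EFinM fineK.
by apply: (le_trans hb); rewrite -{1}(fineK Ifin) -EFinM lee_fin; lra.
Qed.

(** Reflection invariance gives both terms of the difference the same norm, hence the factor 2. *)
Lemma dunkl_norm_root_difference f a : a \in P -> measurable_fun [set: V] f ->
  (norm (fun x => k a * (f x - f (reflection a x))) <= (2 * k a)%:E * norm f)%E.
Proof.
move=> aP mf; have ka := multiplicity_ge0 aP.
have mfs : measurable_fun [set: V] (f \o reflection a).
  exact: measurableT_comp mf (measurable_reflection a).
rewrite dunkl_normZ//; last exact: measurable_funB mf mfs.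
rewrite (mulrC 2) EFinM -muleA; apply: lee_wpmul2l; first by rewrite lee_fin.
apply: (@le_trans _ _ (norm f + norm (\- (f \o reflection a)))%E).
  apply: minkowski_EFin => //; last exact: ltW.
  exact: measurableT_comp mfs.
rewrite dunkl_normN (@dunkl_norm_comp _ _ _ _ _ (reflection a) 1)//.
- by rewrite powR1 mul1e -[X in (X%:E * _)%E]/(1 + 1) EFinD ge0_muleDl ?mul1e ?lee_fin.
- exact: measurable_reflection.
- move=> A mA; rewrite mul1e; apply: (dunkl_measure_reflection hPhi) => //.
  exact: positive_root.
Qed.

Lemma dunkl_gamma_ge0 : 0 <= gamma.
Proof.
rewrite /dunkl_gamma big_seq; apply: sumr_ge0 => a; exact: multiplicity_ge0.
Qed.

(** The constant is 1/(kappa - 2 gamma) with kappa = (N + 2 gamma - p)/p; it does not depend on [e],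
    which allows e -> 0. *)
Lemma regularized_hardy f (e : R) : test_function f -> 0 < e ->
  p * (1 + 2 * gamma) < N%:R + 2 * gamma ->
  (norm (fun x => reg_inv e x * f x) <=
   (p / (N%:R + 2 * gamma - p * (1 + 2 * gamma)))%:E *
   norm (fun x => enorm (dunkl_grad P k f x)))%E.
Proof.
move=> tf e0 pQ; have [sf _] := tf.
have gam0 := dunkl_gamma_ge0.
have pQ' : p < N%:R + 2 * gamma by have := mulr_ge0 (ltW p0) gam0; lra.
have [Aoo kA] := regularized_radial_bound tf e0 pQ'.
have mf := continuous_row_measurable (@smooth_continuous _ _ f sf).
have mE := measurable_euler sf.
have mw := measurable_reg_inv e.
have mB := measurable_dunkl_grad P k sf.
set g := fun x => reg_inv e x * f x in Aoo kA *.
have mg : measurable_fun [set: V] g by exact: measurable_funM.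
set B := norm (fun x => enorm (dunkl_grad P k f x)).
pose F a x := k a * (g x - g (reflection a x)).
have mF a : measurable_fun [set: V] (F a).
  apply: measurable_funM => //; apply: measurable_funB => //.
  exact: measurableT_comp mg (measurable_reflection a).
pose S x := \sum_(a <- P) F a x.
have mS : measurable_fun [set: V] S by exact: measurable_sum.
(* Since [reg_inv e] is reflection invariant, [S] is the weight times the difference terms of
   [euler_dunkl]; adding it leaves only the gradient term. *)
pose G x := reg_inv e x * euler f x + S x.
have mG : measurable_fun [set: V] G.
  by apply: measurable_funD => //; exact: measurable_funM.
have GE x : G x = reg_inv e x * dotp x (dunkl_grad P k f x).
  rewrite /G (euler_dunkl k f x root_sqr) mulrBr -addrA [X in _ + X](_ : _ = 0) ?addr0//.
  rewrite mulr_sumr -sumrN /S -big_split big_seq big1//= => a aP.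
  by rewrite /F /g /reg_inv enorm_reflection ?root_sqr//; ring.
have GB : (norm G <= B)%E.
  apply: le_dunkl_norm => //; apply: aeW => x; rewrite GE [leRHS]ger0_norm ?enorm_ge0//.
  rewrite normrM ger0_norm ?reg_inv_ge0//.
  apply: (@le_trans _ _ (reg_inv e x * (enorm x * enorm (dunkl_grad P k f x)))).
    by rewrite ler_wpM2l ?reg_inv_ge0// dotp_le.
  rewrite mulrA ler_piMl ?enorm_ge0// ler_pdivrMl ?lt_max ?e0 ?orbT//.
  by rewrite mulr1 le_max lexx.
have A0 : (0 <= norm g)%E by exact: dunkl_norm_ge0.
have Afin : norm g \is a fin_num by rewrite ge0_fin_numE.
have SA : (norm S <= (2 * gamma)%:E * norm g)%E.
  apply: le_trans (@dunkl_norm_sum _ _ P k p p0 (ltW p1) _ P F mF) _.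
  apply: (@le_trans _ _ (\sum_(a <- P) (2 * k a * fine (norm g))%:E)%E).
    rewrite big_seq [leRHS]big_seq; apply: lee_sum => a aP.
    by rewrite EFinM fineK//; exact: dunkl_norm_root_difference.
  by rewrite sumEFin -{2}(fineK Afin) -EFinM /dunkl_gamma mulr_sumr mulr_suml.
have kA' : (((N%:R + 2 * gamma - p) / p)%:E * norm g <= B + (2 * gamma)%:E * norm g)%E.
  apply: (le_trans kA).
  rewrite (_ : (fun x => _) = G \+ (\- S)); last first.
    by apply/funext => x; rewrite /G /= addrK.
  apply: (@le_trans _ _ (norm G + norm (\- S))%E).
    by apply: minkowski_EFin; [|exact: measurableT_comp mS|exact: ltW].
  by rewrite dunkl_normN; exact: leeD.
have c0 : 0 < p / (N%:R + 2 * gamma - p * (1 + 2 * gamma)).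
  by rewrite divr_gt0// subr_gt0.
have B0 : (0 <= B)%E by exact: dunkl_norm_ge0.
(* Absorbing the norm of [g] needs real arithmetic, so an infinite gradient norm is set aside
   first. *)
have [->|By] := eqVneq B +oo%E; first by rewrite gt0_muley ?leey ?lte_fin.
have Bfin : B \is a fin_num by rewrite ge0_fin_numE// ltey.
move: kA'; rewrite -(fineK Afin) -(fineK Bfin) -!EFinM -EFinD !lee_fin.
move: (fine (norm g)) (fine B) => A C h.
rewrite mulrAC ler_pdivlMr ?subr_gt0//.
suff : A * (N%:R + 2 * gamma - p) <= (C + 2 * gamma * A) * p by lra.
by rewrite -ler_pdivrMr// (mulrC A) mulrAC.
Qed.

(** On |x| >= 1/(n+1), the regularized weight with e = 1/(n+1) equals 1/|x|. The bounds are uniform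
    in n, and monotone convergence passes to the union of these sets. *)
Lemma hardy f : test_function f -> p * (1 + 2 * gamma) < N%:R + 2 * gamma ->
  (norm (fun x => enorm x `^ (- 1) * f x) <=
   (p / (N%:R + 2 * gamma - p * (1 + 2 * gamma)))%:E *
   norm (fun x => enorm (dunkl_grad P k f x)))%E.
Proof.
move=> tf pQ; have [sf _] := tf.
have mf := continuous_row_measurable (@smooth_continuous _ _ f sf).
set B := (_ * _)%E.
pose h x := enorm x `^ (- 1) * f x.
have mh : measurable_fun [set: V] h.
  apply: measurable_funM => //.
  exact: measurableT_comp (measurable_powR _) measurable_enorm.
pose F (n : nat) : set V := [set x | n.+1%:R^-1 <= enorm x].
have mFn n : measurable (F n).
  rewrite (_ : F n = @enorm R N @^-1` `[n.+1%:R^-1, +oo[%classic).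
    exact: preimage_measurable measurable_enorm _.
  by apply/seteqP; split => x; rewrite /F /= in_itv/= andbT.
have H n : (\int[dunkl_measure P k]_(x in F n) (`|h x| `^ p)%:E <= B `^ p)%E.
  pose e : R := n.+1%:R^-1; have e0 : 0 < e by rewrite invr_gt0.
  have mg : measurable_fun [set: V] (fun x => reg_inv e x * f x).
    by apply: measurable_funM => //; exact: measurable_reg_inv.
  have := regularized_hardy tf e0 pQ; rewrite -/B => HB.
  apply: (@le_trans _ _ (norm (fun x => reg_inv e x * f x) `^ p)%E); last first.
    apply: gt0_ler_poweR; rewrite ?(ltW p0)// in_itv/= leey andbT.
      exact: dunkl_norm_ge0.
    by rewrite (le_trans _ HB)// dunkl_norm_ge0.
  rewrite dunkl_normE -poweRrM mulVf ?gt_eqF// poweRe1; last first.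
    by apply: integral_ge0 => x _; rewrite lee_fin powR_ge0.
  apply: (@le_trans _ _ (\int[dunkl_measure P k]_(x in F n) (`|reg_inv e x * f x| `^ p)%:E)%E).
    rewrite le_eqVlt; apply/orP; left; apply/eqP; apply: eq_integral => x.
    rewrite inE /F /= => ex; rewrite /h /reg_inv powR_inv1 ?enorm_ge0//.
    by rewrite (_ : Num.max _ _ = enorm x)//; apply/max_idPl.
  apply: ge0_subset_integral => //.
  - exact: measurable_norm_powR.
rewrite dunkl_normE.
apply: (@le_trans _ _ ((B `^ p) `^ p^-1)%E); last first.
  rewrite -poweRrM divff ?gt_eqF// poweRe1// mule_ge0 ?dunkl_norm_ge0//.
  by rewrite lee_fin divr_ge0 ?subr_ge0// ltW.
have I0 : (0 <= \int[dunkl_measure P k]_x (`|h x| `^ p)%:E)%E.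
  by apply: integral_ge0 => x _; rewrite lee_fin powR_ge0.
apply: gt0_ler_poweR; rewrite ?invr_ge0 ?(ltW p0)// ?in_itv/= ?leey ?andbT ?poweR_ge0 ?I0//.
have -> : (\int[dunkl_measure P k]_x (`|h x| `^ p)%:E =
    \int[dunkl_measure P k]_(x in \bigcup_n F n) (`|h x| `^ p)%:E)%E.
  rewrite [RHS]integral_mkcond; apply: eq_integral => x _; rewrite patchE.
  case: ifPn => //; rewrite notin_setE => xF.
  (* Only the origin lies outside the union, and there [h] vanishes because 0 to the power -1 is 0
     by convention. *)
  suff -> : h x = 0 by rewrite normr0 powR0 ?gt_eqF.
  rewrite /h (_ : enorm x = 0) ?powR0 ?mul0r// ?oppr_eq0//.
  apply/eqP; rewrite eq_le enorm_ge0 andbT leNgt; apply/negP => x0; apply: xF.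
  have [m _ /(_ m (leqnn m)) hm] := near_infty_natSinv_lt (PosNum x0).
  by exists m => //; exact: ltW.
have nF : nondecreasing_seq F.
  move=> m n mn; apply/subsetPset => x; apply: le_trans.
  by rewrite lef_pV2 ?posrE ?ltr0n// ler_nat.
have cv : (\int[dunkl_measure P k]_(x in F i) (`|h x| `^ p)%:E @[i --> \oo] -->
    \int[dunkl_measure P k]_(x in \bigcup_i F i) (`|h x| `^ p)%:E)%E.
  apply: ge0_nondecreasing_set_cvg_integral => // i.
  by apply: measurable_funTS; apply: measurable_norm_powR.
rewrite -(cvg_lim _ cv)//; apply: lime_le; first by apply/cvg_ex; eexists; exact: cv.
by apply: nearW => n; exact: H.
Qed.

End hardy.

(** * Interpolation of norms by Hoelder's inequality *)

Section interpolation.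
Context {R : realType} {N : nat}.
Local Notation V := 'rV[R]_N.
Variables (P : {fset V}) (k : V -> R).
Local Notation norm p f := (dunkl_norm P k p f%R).

(** For delta = 0 or 1 one Hoelder exponent degenerates, but then r equals q or p and monotonicity
    of the norm suffices. Otherwise Hoelder is applied to |u|^(delta r) and |v|^((1 - delta) r). *)
Lemma dunkl_norm_interpolation (p q r delta : R) (u v w : V -> R) :
  0 < p -> 0 < q -> 0 < r -> 0 <= delta <= 1 ->
  delta * r / p + (1 - delta) * r / q = 1 ->
  measurable_fun [set: V] u -> measurable_fun [set: V] v ->
  measurable_fun [set: V] w ->
  {ae dunkl_measure P k, forall x, `|w x| <= `|u x| `^ delta * `|v x| `^ (1 - delta)} ->
  (norm r w <= norm p u `^ delta * norm q v `^ (1 - delta))%E.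
Proof.
move=> p0 q0 r0 /andP[]; rewrite le_eqVlt => /predU1P[<- _|d0].
  rewrite !mul0r add0r subr0 mul1r => rq mu mv mw wuv.
  have {rq} <- : r = q.
    by rewrite -[RHS]mul1r -rq divfK// gt_eqF.
  rewrite poweRe0 mul1e poweRe1 ?dunkl_norm_ge0//; apply: le_dunkl_norm => //.
  by apply: filterS wuv => x; rewrite powRr0 mul1r powRr1.
rewrite le_eqVlt => /predU1P[->|d1].
  rewrite subrr mul0r mul0r addr0 mul1r => rp mu mv mw wuv.
  have {rp} <- : r = p by rewrite -[RHS]mul1r -rp divfK// gt_eqF.
  rewrite poweRe0 mule1 poweRe1 ?dunkl_norm_ge0//; apply: le_dunkl_norm => //.
  by apply: filterS wuv => x; rewrite powRr0 mulr1 powRr1.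
move=> pq mu mv mw wuv; have d1' : 0 < 1 - delta by rewrite subr_gt0.
have mpow (g : V -> R) s : measurable_fun [set: V] g ->
    measurable_fun [set: V] (fun x => `|g x| `^ s).
  move=> mg; apply: (measurableT_comp (measurable_powR _)).
  exact: measurableT_comp.
have I0 (g : V -> R) s : (0 <= \int[dunkl_measure P k]_x (`|g x| `^ s)%:E)%E.
  by apply: integral_ge0 => x _; rewrite lee_fin powR_ge0.
(* Identifies the 1/r-th power of each Hoelder factor; used with (s, t) = (p, delta) and (q, 1 -
   delta). *)
have half (s t : R) (g : V -> R) : 0 < s -> 0 < t ->
    ('N[dunkl_measure P k]_((s / (t * r))%:E)[EFin \o (fun x => `|g x| `^ (t * r))%R] `^ r^-1 =
    norm s g `^ t)%E.
  move=> s0 t0; rewrite unlock dunkl_normE -!poweRrM invf_div.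
  rewrite (_ : t * r / s / r = s^-1 * t); last by field; rewrite !gt_eqF.
  congr (_ `^ _)%E; apply: eq_integral => x _ /=.
  rewrite ger0_norm ?powR_ge0// -powRrM; congr (_ `^ _)%:E.
  by field; rewrite !gt_eqF.
apply: (@le_trans _ _ (norm r (fun x => `|u x| `^ delta * `|v x| `^ (1 - delta)))).
  apply: le_dunkl_norm => //.
    by apply: measurable_funM; exact: mpow.
  by apply: filterS wuv => x /le_trans; apply; exact: ler_norm.
rewrite dunkl_normE -(half _ _ _ p0 d0) -(half _ _ _ q0 d1') -poweRM ?Lnorm_ge0//.
apply: gt0_ler_poweR;
  rewrite ?invr_ge0 ?(ltW r0) ?in_itv/= ?leey ?andbT ?I0 ?mule_ge0 ?Lnorm_ge0//.
apply: le_trans (hoelder _ _ _ _ _ _); last 5 first.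
- exact: mpow.
- exact: mpow.
- by rewrite divr_gt0 ?mulr_gt0.
- by rewrite divr_gt0 ?mulr_gt0.
- by rewrite !invf_div.
rewrite Lnorm1 le_eqVlt; apply/orP; left; apply/eqP; apply: eq_integral => x _ /=.
rewrite !normrM ?normr_powR ger0_norm ?powR_ge0// ger0_norm ?powR_ge0//.
by rewrite powRM ?powR_ge0// -!powRrM ger0_norm ?powR_ge0// ger0_norm ?powR_ge0.
Qed.

End interpolation.

Theorem theorem6p1 (R : realType) (N : nat) (hN : (1 <= N)%N)
    (Phi Rplus : {fset 'rV[R]_N}) (k : 'rV[R]_N -> R)
    (hPhi : root_system Phi) (hRplus : positive_subsystem Phi Rplus)
    (hk : multiplicity Phi k)
    (p q r delta b c : R)
    (hp : 1 < p < (N%:R + 2 * dunkl_gamma Rplus k) /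
                  (1 + 2 * dunkl_gamma Rplus k))
    (hq : 1 < q) (hr : 0 < r) (hpqr : r <= p + q)
    (hdelta : 0 <= delta <= 1) (hdelta' : (r - q) / r <= delta <= p / r)
    (hpq : delta * r / p + (1 - delta) * r / q = 1)
    (hc : c = - delta + b * (1 - delta)) :
  exists2 C : R, 0 < C &
    forall f : 'rV[R]_N -> R, test_function f ->
      (dunkl_norm Rplus k r (fun x => enorm x `^ c * f x)%R <=
       C%:E *
       dunkl_norm Rplus k p (fun x => enorm (dunkl_grad Rplus k f x))
         `^ delta *
       dunkl_norm Rplus k q (fun x => enorm x `^ b * f x)%R
         `^ (1 - delta))%E.
Proof.
have /andP[p1 pQ] := hp; have p0 : 0 < p by exact: lt_trans p1.
have q0 : 0 < q by exact: lt_trans hq.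
have gam0 := dunkl_gamma_ge0 hRplus hk.
have {}pQ : p * (1 + 2 * dunkl_gamma Rplus k) < N%:R + 2 * dunkl_gamma Rplus k.
  by rewrite -ltr_pdivlMr//; lra.
set C0 := p / (N%:R + 2 * dunkl_gamma Rplus k - p * (1 + 2 * dunkl_gamma Rplus k)).
have C00 : 0 < C0 by rewrite divr_gt0// subr_gt0.
(* The Hardy constant enters to the power with which the gradient norm occurs. *)
exists (C0 `^ delta) => [|f tf]; first exact: powR_gt0.
have mf := continuous_row_measurable (@smooth_continuous _ _ f tf.1).
have mw s : measurable_fun [set: 'rV[R]_N] (fun x => enorm x `^ s * f x).
  apply: measurable_funM => //.
  exact: measurableT_comp (measurable_powR _) measurable_enorm.
have H := hardy hPhi hRplus hk p1 tf pQ.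
apply: (@le_trans _ _ (dunkl_norm Rplus k p (fun x => enorm x `^ (- 1) * f x)%R `^ delta *
  dunkl_norm Rplus k q (fun x => enorm x `^ b * f x)%R `^ (1 - delta))%E).
  apply: dunkl_norm_interpolation => //.
  (* The origin is excluded because powers of 0 take conventional values there: for c = 0 and delta
     > 0 the pointwise bound fails if f does not vanish at 0. *)
  exists [set 0]; split.
  - rewrite (_ : [set 0] = [set x : 'rV[R]_N | enorm x <= 0]).
      exact: measurable_enorm_ball.
    apply/seteqP; split => x /= => [->|x0].
      by rewrite /enorm /dotp big1 ?sqrtr0// => i _; rewrite mxE mul0r.
    by apply: enorm_eq0; apply/eqP; rewrite eq_le x0 enorm_ge0.
  - exact: dunkl_measure_set0.
  move=> x /= /negP; rewrite -ltNge => h; apply: contraPP h => x0; apply/negP; rewrite -leNgt.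
  have s0 : 0 < enorm x.
    rewrite lt_neqAle enorm_ge0 andbT eq_sym; apply/eqP => /enorm_eq0; exact: x0.
  (* Off the origin the two sides are equal: the exponents of |x| add up to -delta + b (1 - delta) =
     c, and those of |f| to 1. *)
  rewrite !normrM !(ger0_norm (powR_ge0 _ _)) !powRM ?powR_ge0// -!powRrM mulrACA.
  rewrite -!powRD ?(gt_eqF s0) ?implybT ?subrKC ?oner_eq0//.
  by rewrite powRr1// hc mulN1r.
rewrite lee_wpmul2r ?poweR_ge0//.
rewrite -poweR_EFin -poweRM ?lee_fin ?(ltW C00) ?dunkl_norm_ge0//.
have /andP[d0 _] := hdelta.
by apply: gt0_ler_poweR => //; rewrite in_itv/= leey andbT ?(le_trans _ H) ?dunkl_norm_ge0.
Qed.
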